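(* Let $Z$ be a smooth manifold and let $H\in\Omega^{2k+1}(Z)$ be a closed differential form of odd degree $2k+1$. Let $\Omega^{\mathrm{ch}}(Z)$ be the algebra of global sections of the chiral de Rham complex of $Z$, with differential $D$, and regard $H$ as an element of its weight zero subspace $\Omega^*(Z)$. Define the twisted differential $D_H:\Omega^{\mathrm{ch}}(Z)\to\Omega^{\mathrm{ch}}(Z)$ by $$D_H(\omega)=D(\omega)+{:}H\omega{:}\,,$$ which coincides at weight zero with the classical twisted differential $d_H=d+H\wedge$. Then $D_H^2=0$.
   Context: Vertex (super)algebras are over $\mathbb{C}$ (differential forms are complexified accordingly); $a\circ_n b$ is the $n$-th product, ${:}ab{:}=a\circ_{-1}b$ the Wick product, $\partial$ the translation operator, and $a(z)b(w)\sim\sum_{n\ge0}(a\circ_nb)(w)(z-w)^{-n-1}$. Chiral de Rham complex $\Omega^{\mathrm{ch}}_Z$ of a smooth manifold $Z$: for an open set $U$ with coordinates $\gamma^1,\dots,\gamma^n$, $\Omega^{\mathrm{ch}}(U)$ is generated by even fields $\beta^i$ and $f$ ($f\in C^\infty(U)$) and odd fields $b^i,c^i$, whose only nontrivial OPEs are $\beta^i(z)f(w)\sim\frac{\partial f}{\partial\gamma^i}(w)(z-w)^{-1}$ and $b^i(z)c^j(w)\sim\delta_{i,j}(z-w)^{-1}$; it is the quotient of the universal enveloping vertex algebra of the corresponding Lie conformal algebra by the ideal generated by $\partial f-\sum_i{:}\frac{\partial f}{\partial\gamma^i}\partial\gamma^i{:}$, ${:}fg{:}-fg$, $1-\mathrm{id}$.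 Under a change of coordinates $\tilde\gamma^i=g^i(\gamma)$, $\gamma^i=f^i(\tilde\gamma)$, the generators are glued by (summing over repeated indices) $\tilde c^i={:}\frac{\partial g^i}{\partial\gamma^j}c^j{:}$, $\tilde b^i={:}\frac{\partial f^j}{\partial\tilde\gamma^i}(g(\gamma))b^j{:}$, $\tilde\beta^i={:}\beta^j\frac{\partial f^j}{\partial\tilde\gamma^i}(g(\gamma)){:}+{:}\frac{\partial^2f^k}{\partial\tilde\gamma^i\partial\tilde\gamma^l}(g(\gamma))\frac{\partial g^l}{\partial\gamma^r}c^rb^k{:}$. This gives a sheaf of vertex algebras on $Z$ (gluing is required only for finite covers; each conformal weight component is an ordinary sheaf). It is bigraded: $f,c^i,b^i,\beta^i$ have weights $0,0,1,1$ and degrees $0,1,-1,0$. The differential $D$ is the zero mode $Q\circ_0$ of the local field $Q=\sum_i{:}\beta^ic^i{:}$; it is globally well defined, square-zero, of degree $1$ and weight $0$, and a derivation of all products $\circ_k$. The weight zero subspace of $\Omega^{\mathrm{ch}}(Z)$ is $\Omega^*(Z)$ ($c^i\leftrightarrow d\gamma^i$), where $D=d$. *)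

(* Defs.v *)
From HB Require Import structures.
From mathcomp Require Import all_boot all_order all_algebra.
From mathcomp Require Import generic_quotient zify.
From mathcomp Require Import all_classical all_reals all_analysis.
From mathcomp Require Import complex.

Set Implicit Arguments.
Unset Strict Implicit.
Unset Printing Implicit Defensive.

Import Order.TTheory GRing.Theory Num.Theory.
Import numFieldNormedType.Exports.

Local Open Scope quotient_scope.
Local Open Scope classical_set_scope.
Local Open Scope ring_scope.

Definition binz (K : fieldType) (m : int) (j : nat) : K :=
  (\prod_(i < j) (m%:~R - i%:R)) / j`!%:R.

(* Meant for [K] of characteristic 0.  The Z/2-grading is given by the subspaces
   [par false] (even) and [par true] (odd).  In the Borcherds identity both
   series have finite support by [va_field], so it is stated for all large
   enough partial sums. *)
Record vertexSuperalgebra (K : fieldType) := VertexSuperalgebra {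
  va_sort :> lmodType K;
  par : bool -> va_sort -> Prop;
  vac : va_sort;
  nprod : int -> va_sort -> va_sort -> va_sort;
  par_lin : forall p k u v, par p u -> par p v -> par p (k *: u + v);
  par_zero : forall p, par p 0;
  par_span : forall v, exists v0 v1, [/\ par false v0, par true v1 & v = v0 + v1];
  par_disj : forall v, par false v -> par true v -> v = 0;
  par_vac : par false vac;
  par_nprod : forall p q n u v, par p u -> par q v -> par (p (+) q) (nprod n u v);
  nprod_linl : forall n k u v w,
    nprod n (k *: u + v) w = k *: nprod n u w + nprod n v w;
  nprod_linr : forall n k u v w,
    nprod n w (k *: u + v) = k *: nprod n w u + nprod n w v;
  va_field : forall a b, exists N : nat, forall n : int,
    N%:Z <= n -> nprod n a b = 0;
  vac_nprod : forall n a, nprod n vac a = if n == -1 then a else 0;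
  nprod_vac : forall a, nprod (-1) a vac = a;
  nprod_vac0 : forall (n : nat) a, nprod n%:Z a vac = 0;
  borcherds : forall (p q : bool) a b c (m n k : int), par p a -> par q b ->
    exists N : nat, forall M : nat, (N <= M)%N ->
      \sum_(j < M) binz K m j *:
        nprod (m + k - j%:Z) (nprod (n + j%:Z) a b) c
      = \sum_(j < M) ((-1) ^+ j * binz K n j) *:
        (nprod (m + n - j%:Z) a (nprod (k + j%:Z) b c)
         - ((-1) ^ n * (-1) ^+ (p && q)) *:
             nprod (n + k - j%:Z) b (nprod (m + j%:Z) a c))
}.

Arguments par {K V} : rename.
Arguments vac {K V} : rename.
Arguments nprod {K V} : rename.

(* [a ∙ b] is the Wick product; it nests to the right, as iterated Wick
   products do. *)
Notation "a ∘_( n ) b" := (nprod n a b)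
  (at level 40, left associativity, format "a  ∘_( n )  b") : ring_scope.
Notation "a ∙ b" := (nprod (-1) a b)
  (at level 38, right associativity) : ring_scope.

Definition transl (K : fieldType) (V : vertexSuperalgebra K) (a : V) : V :=
  a ∘_( -2 ) vac.

Section Locality.
Variable K : fieldType.
Implicit Type V : vertexSuperalgebra K.

(* The OPE of [a] and [b] has a pole of order at most [N]. *)
Definition pole V (N : nat) (a b : V) : Prop :=
  forall n : int, N%:Z <= n -> a ∘_(n) b = 0.

Lemma pole_le V N N' (a b : V) : (N <= N')%N -> pole N a b -> pole N' a b.
Proof. by move=> le h n hn; apply: h; lia. Qed.

Lemma nprod0l V n (b : V) : 0 ∘_(n) b = 0.
Proof.
have := nprod_linl n (-1) 0 0 b.
by rewrite scaler0 addr0 scaleN1r addNr.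
Qed.

Lemma nprod0r V n (b : V) : b ∘_(n) 0 = 0.
Proof.
have := nprod_linr n (-1) 0 0 b.
by rewrite scaler0 addr0 scaleN1r addNr.
Qed.

Lemma nprodDl V n (a b c : V) : (a + b) ∘_(n) c = a ∘_(n) c + b ∘_(n) c.
Proof. by have := nprod_linl n 1 a b c; rewrite !scale1r. Qed.

Lemma nprodDr V n (a b c : V) : c ∘_(n) (a + b) = c ∘_(n) a + c ∘_(n) b.
Proof. by have := nprod_linr n 1 a b c; rewrite !scale1r. Qed.

Lemma nprodZl V n k (a c : V) : (k *: a) ∘_(n) c = k *: (a ∘_(n) c).
Proof. by have := nprod_linl n k a 0 c; rewrite nprod0l !addr0. Qed.

Lemma nprodZr V n k (a c : V) : c ∘_(n) (k *: a) = k *: (c ∘_(n) a).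
Proof. by have := nprod_linr n k a 0 c; rewrite nprod0r !addr0. Qed.

Lemma sum_stable (V : lmodType K) (F : nat -> V) (N M : nat) : (N <= M)%N ->
  (forall j, (N <= j)%N -> F j = 0) -> \sum_(j < M) F j = \sum_(j < N) F j.
Proof.
move=> le h; rewrite -!(big_mkord xpredT F) (big_cat_nat (n := N)) //=.
rewrite [X in _ + X]big_nat_cond [X in _ + X]big1 ?addr0 // => i.
by rewrite andbT => /andP[hi _]; apply: h.
Qed.

Lemma borcherds_pole V (p q : bool) (a b c : V) (m n k : int) (N M : nat) :
    par p a -> par q b -> pole N a b -> pole N b c -> pole N a c ->
    (N + `|m| + `|n| + `|k| <= M)%N ->
  \sum_(j < M) binz K m j *:
     ((a ∘_(n + j%:Z) b) ∘_(m + k - j%:Z) c)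
  = \sum_(j < M) ((-1) ^+ j * binz K n j) *:
     (a ∘_(m + n - j%:Z) (b ∘_(k + j%:Z) c)
      - ((-1) ^ n * (-1) ^+ (p && q)) *:
          (b ∘_(n + k - j%:Z) (a ∘_(m + j%:Z) c))).
Proof.
move=> pa qb lab lbc lac hM.
have [N0 hN0] := borcherds c m n k pa qb.
have := hN0 (maxn N0 M) (leq_maxl _ _).
rewrite (@sum_stable _ (fun j => binz K m j *:
     ((a ∘_(n + j%:Z) b) ∘_(m + k - j%:Z) c)) M) ?leq_maxr //; last first.
  by move=> j hj; rewrite lab ?nprod0l ?scaler0 //; lia.
rewrite (@sum_stable _ (fun j => ((-1) ^+ j * binz K n j) *:
     (a ∘_(m + n - j%:Z) (b ∘_(k + j%:Z) c)
      - ((-1) ^ n * (-1) ^+ (p && q)) *: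
          (b ∘_(n + k - j%:Z) (a ∘_(m + j%:Z) c)))) M) ?leq_maxr //.
move=> j hj; rewrite lbc ?lac ?nprod0r ?scaler0 ?subr0 ?scaler0 //; lia.
Qed.

Lemma binz0 m : binz K m 0 = 1.
Proof. by rewrite /binz big_ord0 fact0 divr1. Qed.

Lemma binz00 j : binz K 0 j.+1 = 0.
Proof. by rewrite /binz big_ord_recl /= subrr !mul0r. Qed.

(* Dong's lemma; the bound depends only on the orders of the poles. *)
Lemma dong_l (N : nat) (k : int) : exists N', forall V (p q : bool) (a b c : V),
  par p a -> par q b -> pole N a b -> pole N b c -> pole N a c ->
  pole N' (a ∘_(k) b) c.
Proof.
suff h : forall d : nat, exists N', forall V (p q : bool) (a b c : V) (l : int),
    par p a -> par q b -> pole N a b -> pole N b c -> pole N a c ->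
    N%:Z - d%:Z <= l -> pole N' (a ∘_(l) b) c.
  have [N' h'] := h (N + `|k|)%N.
  by exists N' => V p q a b c *; apply: (h' _ p q) => //; lia.
elim=> [|d [N' IH]].
  exists 0%N => V p q a b c l pa qb lab lbc lac hl x _.
  by rewrite lab ?nprod0l //; lia.
exists (N' + N + N + d)%N => V p q a b c l pa qb lab lbc lac hl x hx.
have [hl'|hl'] := boolP (N%:Z - d%:Z <= l).
  by apply: (IH _ p q a b c l) => //; lia.
pose y := x - N%:Z.
pose M := (N + `|N%:Z| + `|l| + `|y|).+1%N.
have := @borcherds_pole V p q a b c N%:Z l y N M pa qb lab lbc lac (leqnSn _).
rewrite [X in _ = X -> _]big1; last first.
  move=> j _; rewrite lbc ?lac ?nprod0r ?scaler0 ?subr0 ?scaler0 //; lia.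
rewrite big_ord_recl /= binz0 scale1r big1 => [|j _].
  have -> : l + 0%:Z = l by lia.
  have -> : N%:Z + y - 0%:Z = x by lia.
  by rewrite addr0.
have [hj|hj] := boolP (d < bump 0 j)%N.
  by rewrite lab ?nprod0l ?scaler0 //; lia.
by rewrite (IH _ p q a b c) ?scaler0 // /bump /=; move: hj; rewrite /bump /=; lia.
Qed.

Lemma dong_r (N : nat) (k : int) : exists N', forall V (p q : bool) (a b c : V),
  par p a -> par q b -> pole N a b -> pole N b c -> pole N a c ->
  pole N' a (b ∘_(k) c).
Proof.
suff [N' h] : exists N', forall V (p q : bool) (a b c : V) (j : 'I_N),
    par p a -> par q b -> pole N a b -> pole N b c -> pole N a c ->
    pole N' (a ∘_(j%:Z) b) c.
  exists (N' + N + N + `|k|)%N => V p q a b c pa qb lab lbc lac x hx.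
  pose M := (N + `|x| + `|0%:Z| + `|k|).+1%N.
  have := @borcherds_pole V p q a b c x 0 k N M pa qb lab lbc lac (leqnSn _).
  rewrite big1 => [|j _]; last first.
    rewrite add0r; have [hj|hj] := boolP (j < N)%N.
      by rewrite (h _ p q a b c (Ordinal hj)) ?scaler0 //=; lia.
    by rewrite lab ?nprod0l ?scaler0 //; lia.
  rewrite big_ord_recl /= binz0 expr0 mulr1 scale1r big1 => [|j _]; last first.
    by rewrite binz00 mulr0 scale0r.
  have -> : x + 0 - 0%:Z = x by lia.
  have -> : k + 0%:Z = k by lia.
  rewrite addr0 (lac (x + 0%:Z)) ?nprod0r ?scaler0 ?subr0; last by lia.
  exact: esym.
have [F hF] := boolp.choice (fun j : nat => dong_l N j%:Z).
exists (\max_(j < N) F j) => V p q a b c j pa qb lab lbc lac.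
by apply: pole_le (hF j V p q a b c pa qb lab lbc lac); apply: leq_bigmax.
Qed.

End Locality.

Inductive term (K G : Type) :=
  | TGen of G
  | TZero
  | TVac
  | TAdd of term K G & term K G
  | TScale of K & term K G
  | TProd of int & term K G & term K G.

Arguments TGen {K G}. Arguments TZero {K G}. Arguments TVac {K G}.

Fixpoint ev (K : fieldType) (G : Type) (V : vertexSuperalgebra K) (rho : G -> V)
    (t : term K G) : V :=
  match t with
  | TGen g => rho g
  | TZero => 0
  | TVac => vac
  | TAdd s u => ev rho s + ev rho u
  | TScale k s => k *: ev rho s
  | TProd n s u => ev rho s ∘_(n) ev rho u
  end.

Section Smooth.
Variables (R : realType) (n : nat).
Local Notation E := 'rV[R]_n.

Definition partial (i : 'I_n) (f : E -> R) : E -> R :=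
  fun x => 'D_(delta_mx 0 i) f x.

(* Infinitely (Frechet) differentiable: every iterated partial derivative is
   differentiable.  For open [U] this only depends on the restriction of [f]. *)
Definition rsmooth (U : set E) (f : E -> R) : Prop :=
  forall (s : seq 'I_n) x, U x -> differentiable (foldr partial f s) x.

Definition Ref (f : E -> R[i]) : E -> R := fun x => complex.Re (f x).
Definition Imf (f : E -> R[i]) : E -> R := fun x => complex.Im (f x).

Definition csmooth (U : set E) (f : E -> R[i]) : Prop :=
  rsmooth U (Ref f) /\ rsmooth U (Imf f).

Definition cpartial (i : 'I_n) (f : E -> R[i]) : E -> R[i] :=
  fun x => Complex (partial i (Ref f) x) (partial i (Imf f) x).

Definition cplx (f : E -> R) : E -> R[i] := fun x => (f x)%:C%C.

Definition coord (i : 'I_n) : E -> R := fun x => x 0 i.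

Definition comp_ (g : E -> E) (i : 'I_n) : E -> R := fun x => g x 0 i.

End Smooth.

Section Local.
Variables (R : realType) (n : nat) (U : set 'rV[R]_n).
Local Notation E := 'rV[R]_n.
Local Notation C := (R[i]).

Inductive chgen :=
  | GFun of {f : E -> C | csmooth U f}
  | GBeta of 'I_n
  | GB of 'I_n
  | GC of 'I_n.

Definition gpar (g : chgen) : bool :=
  match g with GFun _ | GBeta _ => false | GB _ | GC _ => true end.

Definition gwt (g : chgen) : int :=
  match g with GFun _ | GC _ => 0 | GBeta _ | GB _ => 1 end.

(* The image of the generator [f]; the junk value 0 is only there to avoid
   carrying smoothness proofs. *)
Definition fn (V : vertexSuperalgebra C) (rho : chgen -> V) (f : E -> C) : V :=
  if pselect (csmooth U f) is left h then rho (GFun (exist _ f h)) else 0.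

(* The coefficient of (z-w)^-1 in the OPE of two generators; the entries
   (f, beta) and (c, b) are forced by skew-symmetry. *)
Definition ope (V : vertexSuperalgebra C) (rho : chgen -> V) (x y : chgen) : V :=
  match x, y with
  | GBeta i, GFun f => fn rho (cpartial i (sval f))
  | GFun f, GBeta i => - fn rho (cpartial i (sval f))
  | GB i, GC j => if i == j then fn rho (fun=> 1) else 0
  | GC i, GB j => if i == j then fn rho (fun=> 1) else 0
  | _, _ => 0
  end.

(* [rho] is induced by a morphism from the Lie conformal algebra spanned by the
   generators ([ch_par] to [ch_ope]), whose extension to the universal enveloping
   vertex algebra kills the defining ideal ([ch_transl] to [ch_one]). *)
Record chiral_model (V : vertexSuperalgebra C) (rho : chgen -> V) : Prop := {
  ch_par : forall g, par (gpar g) (rho g);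
  ch_eq : forall f g : E -> C, csmooth U f -> csmooth U g ->
    (forall x, U x -> f x = g x) -> fn rho f = fn rho g;
  ch_lin : forall (k : C) (f g : E -> C), csmooth U f -> csmooth U g ->
    fn rho (fun x => k * f x + g x) = k *: fn rho f + fn rho g;
  ch_ope : forall x y (m : nat),
    rho x ∘_(m%:Z) rho y = if m == 0%N then ope rho x y else 0;
  ch_transl : forall f : E -> C, csmooth U f ->
    transl (fn rho f)
    = \sum_i fn rho (cpartial i f) ∙ transl (fn rho (cplx (@coord R n i)));
  ch_mul : forall f g : E -> C, csmooth U f -> csmooth U g ->
    fn rho f ∙ fn rho g = fn rho (fun x => f x * g x);
  ch_one : fn rho (fun=> 1) = vac
}.

Definition chterm := term C chgen.

HB.instance Definition _ := gen_eqMixin chterm.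
HB.instance Definition _ := gen_choiceMixin chterm.

(* Omega_ch(U) is the quotient of the algebra of all formal expressions in the
   generators by the relations that follow from the axioms of vertex
   superalgebras and [chiral_model]. *)
Definition teq : rel chterm := fun s t =>
  `[< forall (V : vertexSuperalgebra C) (rho : chgen -> V),
        chiral_model rho -> ev rho s = ev rho t >].

Fact teq_refl : reflexive teq.
Proof. by move=> s; apply/asboolP. Qed.

Fact teq_sym : symmetric teq.
Proof.
by move=> s t; apply/asboolP/asboolP => h V rho hrho; rewrite h.
Qed.

Fact teq_trans : transitive teq.
Proof.
move=> t s u /asboolP h1 /asboolP h2; apply/asboolP => V rho hrho.
by rewrite h1 ?h2.
Qed.

Definition teq_equiv := EquivRel teq teq_refl teq_sym teq_trans.

Definition Om := {eq_quot teq_equiv}.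
HB.instance Definition _ := Choice.on Om.

Definition cls (t : chterm) : Om := \pi_Om t.

Definition evq (V : vertexSuperalgebra C) (rho : chgen -> V) (x : Om) : V :=
  ev rho (repr x).

Lemma evq_cls V rho t : @chiral_model V rho -> evq rho (cls t) = ev rho t.
Proof.
move=> hrho; rewrite /evq /cls.
have /eqmodP/asboolP : repr (\pi_Om t) = t %[mod Om] by rewrite reprK.
by apply.
Qed.

Lemma evq_inj (x y : Om) :
  (forall V rho, @chiral_model V rho -> evq rho x = evq rho y) -> x = y.
Proof.
by move=> h; rewrite -[x]reprK -[y]reprK; apply/eqmodP/asboolP.
Qed.

Definition Om_add (x y : Om) : Om := cls (TAdd (repr x) (repr y)).
Definition Om_scale (k : C) (x : Om) : Om := cls (TScale k (repr x)).
Definition Om_zero : Om := cls TZero.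
Definition Om_prod (m : int) (x y : Om) : Om := cls (TProd m (repr x) (repr y)).
Definition Om_par (p : bool) (x : Om) : Prop :=
  forall V rho, @chiral_model V rho -> par p (evq rho x).

Section OmEv.
Variables (V : vertexSuperalgebra C) (rho : chgen -> V) (hrho : chiral_model rho).
Let evE t := @evq_cls V rho t hrho.

Lemma evq_add x y : evq rho (Om_add x y) = evq rho x + evq rho y.
Proof. by rewrite evE. Qed.
Lemma evq_scale k x : evq rho (Om_scale k x) = k *: evq rho x.
Proof. by rewrite evE. Qed.
Lemma evq_zero : evq rho Om_zero = 0.
Proof. by rewrite evE. Qed.
Lemma evq_prod m x y : evq rho (Om_prod m x y) = evq rho x ∘_(m) evq rho y.
Proof. by rewrite evE. Qed.
Lemma evq_vac : evq rho (cls TVac) = vac.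
Proof. by rewrite evE. Qed.
End OmEv.

Lemma Om_addA : associative Om_add.
Proof. by move=> x y z; apply: evq_inj => V rho h; rewrite !evq_add // addrA. Qed.
Lemma Om_addC : commutative Om_add.
Proof. by move=> x y; apply: evq_inj => V rho h; rewrite !evq_add // addrC. Qed.
Lemma Om_add0 : left_id Om_zero Om_add.
Proof. by move=> x; apply: evq_inj => V rho h; rewrite evq_add // evq_zero // add0r. Qed.
Lemma Om_addN : left_inverse Om_zero (Om_scale (-1)) Om_add.
Proof.
move=> x; apply: evq_inj => V rho h.
by rewrite evq_add // evq_scale // evq_zero // scaleN1r addNr.
Qed.
HB.instance Definition _ := GRing.isZmodule.Build Om Om_addA Om_addC Om_add0 Om_addN.

Lemma Om_scaleA k l (x : Om) : Om_scale k (Om_scale l x) = Om_scale (k * l) x.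
Proof. by apply: evq_inj => V rho h; rewrite !evq_scale // scalerA. Qed.
Lemma Om_scale1 : left_id 1 Om_scale.
Proof. by move=> x; apply: evq_inj => V rho h; rewrite evq_scale // scale1r. Qed.
Lemma Om_scaleDr : right_distributive Om_scale +%R.
Proof.
move=> k x y; apply: evq_inj => V rho h.
by rewrite evq_scale // !evq_add // !evq_scale // scalerDr.
Qed.
Lemma Om_scaleDl (x : Om) : {morph Om_scale^~ x : k l / k + l}.
Proof.
by move=> k l; apply: evq_inj => V rho h; rewrite evq_add // !evq_scale // scalerDl.
Qed.
HB.instance Definition _ := GRing.Zmodule_isLmodule.Build C Om
  Om_scaleA Om_scale1 Om_scaleDr Om_scaleDl.

(* Omega_ch(U) is a vertex superalgebra: the only point is that the pole of two
   expressions is bounded independently of the model. *)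
Fixpoint part (p : bool) (t : chterm) : chterm :=
  match t with
  | TGen g => if p == gpar g then t else TZero
  | TZero => TZero
  | TVac => if p then TZero else TVac
  | TAdd s u => TAdd (part p s) (part p u)
  | TScale k s => TScale k (part p s)
  | TProd m s u => TAdd (TProd m (part false s) (part p u))
                        (TProd m (part true s) (part (~~ p) u))
  end.

Section Part.
Variables (V : vertexSuperalgebra C) (rho : chgen -> V) (hrho : chiral_model rho).

Lemma par_part p t : par p (ev rho (part p t)).
Proof.
have addP q (u v : V) : par q u -> par q v -> par q (u + v).
  by move=> hu hv; rewrite -[u]scale1r; apply: par_lin.
elim: t p => [g|||s IHs u IHu|k s IHs|m s IHs u IHu] p /=.
- by case: eqP => [->|_] /=; [apply: ch_par | apply: par_zero].
- exact: par_zero.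
- by case: p => /=; [apply: par_zero | apply: par_vac].
- exact: addP.
- by rewrite -[X in par _ X]addr0; apply: par_lin => //; apply: par_zero.
- apply: addP; first exact: (@par_nprod _ _ false p).
  by have := @par_nprod _ _ true (~~ p) m _ _ (IHs true) (IHu (~~ p)); rewrite /= negbK.
Qed.

Lemma ev_part t : ev rho t = ev rho (part false t) + ev rho (part true t).
Proof.
elim: t => [g|||s IHs u IHu|k s IHs|m s IHs u IHu] /=.
- by case: (gpar g); rewrite /= ?addr0 ?add0r.
- by rewrite addr0.
- by rewrite addr0.
- by rewrite {1}IHs {1}IHu addrACA.
- by rewrite {1}IHs scalerDr.
- rewrite {1}IHs {1}IHu !nprodDl !nprodDr -!addrA; congr (_ + _).
  by rewrite addrA addrC.
Qed.
End Part.


Definition bounded (s t : chterm) : Prop := exists N, forall p q V rho,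
  @chiral_model V rho -> pole N (ev rho (part p s)) (ev rho (part q t)).

Lemma bounded3 s t s' t' s'' t'' :
  bounded s t -> bounded s' t' -> bounded s'' t'' ->
  exists N, forall p q V rho, @chiral_model V rho ->
    [/\ pole N (ev rho (part p s)) (ev rho (part q t)),
        pole N (ev rho (part p s')) (ev rho (part q t')) &
        pole N (ev rho (part p s'')) (ev rho (part q t''))].
Proof.
move=> [N1 h1] [N2 h2] [N3 h3]; exists (N1 + N2 + N3)%N => p q V rho h.
by split; [apply: pole_le (h1 p q _ _ h) | apply: pole_le (h2 p q _ _ h)
  | apply: pole_le (h3 p q _ _ h)]; lia.
Qed.

Lemma bounded_prodl m s u t :
  bounded s u -> bounded u t -> bounded s t -> bounded (TProd m s u) t.
Proof.
move=> b1 b2 b3; have [N hN] := bounded3 b1 b2 b3.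
have [N' hN'] := dong_l C N m.
exists N' => p q V rho h k hk /=; rewrite nprodDl.
have [[s0 _ t0] [s1 _ t1]] := (hN false q _ _ h, hN true q _ _ h).
have [[v0 _ _] [v1 _ _]] := (hN false p _ _ h, hN true (~~ p) _ _ h).
have [[_ u0 _] [_ u1 _]] := (hN p q _ _ h, hN (~~ p) q _ _ h).
rewrite (hN' V false p) // ?(hN' V true (~~ p)) ?addr0 //; exact: par_part.
Qed.

Lemma bounded_prodr m s u t :
  bounded t s -> bounded s u -> bounded t u -> bounded t (TProd m s u).
Proof.
move=> b1 b2 b3; have [N hN] := bounded3 b1 b2 b3.
have [N' hN'] := dong_r C N m.
exists N' => q p V rho h k hk /=; rewrite nprodDr.
have [[s0 _ _] [s1 _ _]] := (hN q false _ _ h, hN q true _ _ h).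
have [[_ v0 _] [_ v1 _]] := (hN false p _ _ h, hN true (~~ p) _ _ h).
have [[_ _ u0] [_ _ u1]] := (hN q p _ _ h, hN q (~~ p) _ _ h).
rewrite (hN' V q false) // ?(hN' V q true) ?addr0 //; exact: par_part.
Qed.

Fixpoint tsize (t : chterm) : nat :=
  match t with
  | TAdd s u | TProd _ s u => (tsize s + tsize u).+1
  | TScale _ s => (tsize s).+1
  | _ => 0
  end.

Lemma boundedP (s t : chterm) : bounded s t.
Proof.
have [k] := ubnP (tsize s + tsize t); elim: k => // k IH in s t *.
rewrite ltnS => hk.
have pole0l (V : vertexSuperalgebra C) N (b : V) : @pole C V N 0 b by move=> m _; rewrite nprod0l.
have pole0r (V : vertexSuperalgebra C) N (b : V) : @pole C V N b 0 by move=> m _; rewrite nprod0r.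
case: s hk => [g|||s1 s2|a s1|m s1 s2] /= hk.
- case: t hk => [g'|||t1 t2|a t1|m t1 t2] /= hk.
  + exists 1%N => p q V rho h /=.
    do 2![case: eqP => _ //=] => -[[//|m]|//] _.
    by rewrite (ch_ope h).
  + by exists 0%N.
  + exists 0%N => p [] V rho h //= -[m|//] _.
    exact: nprod_vac0.
  + have [[N1 h1] [N2 h2]] : bounded (TGen g) t1 /\ bounded (TGen g) t2.
      by split; apply: IH => /=; lia.
    exists (N1 + N2)%N => p q V rho h x hx; rewrite [part q _]/= [ev rho (TAdd _ _)]/=.
    by rewrite nprodDr (h1 p q _ _ h) ?(h2 p q _ _ h) ?addr0 //; lia.
  + have [N1 h1] : bounded (TGen g) t1 by apply: IH => /=; lia.
    exists N1 => p q V rho h x hx; rewrite [part q _]/= [ev rho (TScale _ _)]/=.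
    by rewrite nprodZr (h1 p q _ _ h) ?scaler0.
  + by apply: bounded_prodr; apply: IH => /=; lia.
- by exists 0%N.
- exists 0%N => -[] q V rho h //= x hx.
  by rewrite vac_nprod; case: eqP => // e; move: hx; rewrite e.
- have [[N1 h1] [N2 h2]] : bounded s1 t /\ bounded s2 t.
    by split; apply: IH => /=; lia.
  exists (N1 + N2)%N => p q V rho h x hx /=.
  by rewrite nprodDl (h1 p q _ _ h) ?(h2 p q _ _ h) ?addr0 //; lia.
- have [N1 h1] : bounded s1 t by apply: IH => /=; lia.
  by exists N1 => p q V rho h x hx /=; rewrite nprodZl (h1 p q _ _ h) ?scaler0.
- by apply: bounded_prodl; apply: IH => /=; lia.
Qed.

Lemma Om_pole (x y : Om) : exists N, forall V rho, @chiral_model V rho ->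
  pole N (evq rho x) (evq rho y).
Proof.
have [N hN] := boundedP (repr x) (repr y); exists N => V rho h m hm.
rewrite /evq (ev_part rho (repr x)) (ev_part rho (repr y)) !nprodDl !nprodDr.
by rewrite !hN // !addr0.
Qed.

Lemma evq0 V rho : @chiral_model V rho -> evq rho 0 = 0.
Proof. exact: evq_zero. Qed.
Lemma evqD V rho : @chiral_model V rho -> {morph evq rho : x y / x + y}.
Proof. by move=> h x y; apply: evq_add. Qed.
Lemma evqZ V rho : @chiral_model V rho -> forall k, {morph evq rho : x / k *: x}.
Proof. by move=> h k x; apply: evq_scale. Qed.
Lemma evqB V rho : @chiral_model V rho -> {morph evq rho : x y / x - y}.
Proof. by move=> h x y; rewrite -scaleN1r evqD // evqZ // scaleN1r. Qed.
Lemma evq_sum V rho : @chiral_model V rho -> forall (I : Type) (r : seq I) P F,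
  evq rho (\sum_(i <- r | P i) F i) = \sum_(i <- r | P i) evq rho (F i).
Proof. by move=> h I r P F; exact: (big_morph _ (evqD h) (evq0 h)). Qed.

Fact Om_par_lin p k (u v : Om) : Om_par p u -> Om_par p v -> Om_par p (k *: u + v).
Proof.
by move=> hu hv V rho h; rewrite evqD // evqZ //; apply: par_lin; [apply: hu | apply: hv].
Qed.

Fact Om_par_zero p : Om_par p (0 : Om).
Proof. by move=> V rho h; rewrite evq0 //; apply: par_zero. Qed.

Fact Om_par_span (v : Om) :
  exists v0 v1, [/\ Om_par false v0, Om_par true v1 & v = v0 + v1].
Proof.
exists (cls (part false (repr v))), (cls (part true (repr v))); split.
- by move=> V rho h; rewrite evq_cls //; apply: par_part.
- by move=> V rho h; rewrite evq_cls //; apply: par_part.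
- by apply: evq_inj => V rho h; rewrite evqD // !evq_cls // -ev_part.
Qed.

Fact Om_par_disj (v : Om) : Om_par false v -> Om_par true v -> v = 0.
Proof.
move=> h0 h1; apply: evq_inj => V rho h; rewrite evq0 //.
by apply: par_disj; [apply: h0 | apply: h1].
Qed.

Fact Om_par_vac : Om_par false (cls TVac).
Proof. by move=> V rho h; rewrite evq_cls //; apply: par_vac. Qed.

Fact Om_par_prod p q m (u v : Om) :
  Om_par p u -> Om_par q v -> Om_par (p (+) q) (Om_prod m u v).
Proof.
by move=> hu hv V rho h; rewrite evq_prod //; apply: par_nprod; [apply: hu | apply: hv].
Qed.

Fact Om_prod_linl m k (u v w : Om) :
  Om_prod m (k *: u + v) w = k *: Om_prod m u w + Om_prod m v w.
Proof.
apply: evq_inj => V rho h; rewrite evqD // evqZ // !evq_prod // evqD // evqZ //.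
exact: nprod_linl.
Qed.

Fact Om_prod_linr m k (u v w : Om) :
  Om_prod m w (k *: u + v) = k *: Om_prod m w u + Om_prod m w v.
Proof.
apply: evq_inj => V rho h; rewrite evqD // evqZ // !evq_prod // evqD // evqZ //.
exact: nprod_linr.
Qed.

Fact Om_field (a b : Om) : exists N : nat, forall m : int,
  N%:Z <= m -> Om_prod m a b = 0.
Proof.
have [N hN] := Om_pole a b; exists N => m hm; apply: evq_inj => V rho h.
by rewrite evq_prod // evq0 // hN.
Qed.

Fact Om_vac_prod m (a : Om) : Om_prod m (cls TVac) a = if m == -1 then a else 0.
Proof.
apply: evq_inj => V rho h; rewrite evq_prod // evq_vac // vac_nprod.
by case: ifP => _ //; rewrite evq0.
Qed.

Fact Om_prod_vac (a : Om) : Om_prod (-1) a (cls TVac) = a.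
Proof. by apply: evq_inj => V rho h; rewrite evq_prod // evq_vac // nprod_vac. Qed.

Fact Om_prod_vac0 (m : nat) (a : Om) : Om_prod m%:Z a (cls TVac) = 0.
Proof.
by apply: evq_inj => V rho h; rewrite evq_prod // evq_vac // nprod_vac0 evq0.
Qed.

Fact Om_borcherds (p q : bool) (a b c : Om) (m l k : int) :
  Om_par p a -> Om_par q b ->
  exists N : nat, forall M : nat, (N <= M)%N ->
    \sum_(j < M) binz C m j *:
      Om_prod (m + k - j%:Z) (Om_prod (l + j%:Z) a b) c
    = \sum_(j < M) ((-1) ^+ j * binz C l j) *:
      (Om_prod (m + l - j%:Z) a (Om_prod (k + j%:Z) b c)
       - ((-1) ^ l * (-1) ^+ (p && q)) *:
           Om_prod (l + k - j%:Z) b (Om_prod (m + j%:Z) a c)).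
Proof.
move=> pa qb.
have [[N1 h1] [N2 h2]] := (Om_pole a b, Om_pole b c); have [N3 h3] := Om_pole a c.
pose N := (N1 + N2 + N3)%N.
exists (N + `|m| + `|l| + `|k|)%N => M hM; apply: evq_inj => V rho h.
rewrite !evq_sum //.
have := @borcherds_pole _ V p q (evq rho a) (evq rho b) (evq rho c) m l k N M
  (pa _ _ h) (qb _ _ h).
move=> /(_ _ _ _ hM) e.
transitivity (\sum_(j < M) binz C m j *:
     ((evq rho a ∘_(l + j%:Z) evq rho b) ∘_(m + k - j%:Z) evq rho c)).
  by apply: eq_bigr => j _; rewrite evqZ // !evq_prod.
rewrite e; last first.
- by apply: pole_le (h3 _ _ h); rewrite /N; lia.
- by apply: pole_le (h2 _ _ h); rewrite /N; lia.
- by apply: pole_le (h1 _ _ h); rewrite /N; lia.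
by apply: eq_bigr => j _; rewrite evqZ // evqB // evqZ // !evq_prod.
Qed.

Definition Omega_ch : vertexSuperalgebra C :=
  @VertexSuperalgebra C Om Om_par (cls TVac) Om_prod
    Om_par_lin Om_par_zero Om_par_span Om_par_disj Om_par_vac Om_par_prod
    Om_prod_linl Om_prod_linr Om_field Om_vac_prod Om_prod_vac Om_prod_vac0
    Om_borcherds.

Definition gen (g : chgen) : Omega_ch := cls (TGen g).

Lemma evq_gen V rho g : @chiral_model V rho -> evq rho (gen g) = rho g.
Proof. by move=> h; rewrite evq_cls. Qed.

Lemma evq_fn V rho f : @chiral_model V rho -> evq rho (fn gen f) = fn rho f.
Proof.
by move=> h; rewrite /fn; case: pselect => hf; rewrite ?evq_gen // evq0.
Qed.

Lemma gen_model : chiral_model gen.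
Proof.
split.
- by move=> g V rho h; rewrite evq_gen //; apply: ch_par.
- move=> f g hf hg e; apply: evq_inj => V rho h.
  by rewrite !evq_fn //; apply: (ch_eq h).
- move=> k f g hf hg; apply: evq_inj => V rho h.
  by rewrite evqD // evqZ // !evq_fn // (ch_lin h).
- move=> x y m; apply: evq_inj => V rho h.
  rewrite evq_prod // !evq_gen // (ch_ope h).
  case: eqP => _; last by rewrite evq0.
  case: x y => [f|i|i|i] [g|j|j|j] /=; rewrite ?evq0 ?evq_fn //.
  + by rewrite -[- fn gen _]scaleN1r evqZ // evq_fn // scaleN1r.
  + by case: eqP => _; rewrite ?evq_fn ?evq0.
  + by case: eqP => _; rewrite ?evq_fn ?evq0.
- move=> f hf; apply: evq_inj => V rho h.
  rewrite evq_sum // evq_prod // evq_vac // evq_fn // -[LHS]/(transl _) (ch_transl h) //.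
  by apply: eq_bigr => i _; rewrite !evq_prod // evq_vac // !evq_fn.
- move=> f g hf hg; apply: evq_inj => V rho h.
  by rewrite evq_prod // !evq_fn // (ch_mul h).
- by apply: evq_inj => V rho h; rewrite evq_fn // evq_vac // (ch_one h).
Qed.

Lemma ev_gen t : ev gen t = cls t.
Proof.
apply: evq_inj => V rho h; rewrite evq_cls //.
elim: t => [g|||s IHs u IHu|k s IHs|m s IHs u IHu] /=.
- exact: evq_gen.
- exact: evq0.
- exact: evq_vac.
- by rewrite evqD // IHs IHu.
- by rewrite evqZ // IHs.
- by rewrite evq_prod // IHs IHu.
Qed.

End Local.

Section LocalOps.
Variables (R : realType) (n : nat) (U : set 'rV[R]_n).
Local Notation C := (R[i]).

Definition fnO (f : 'rV[R]_n -> C) : Omega_ch U := fn (@gen R n U) f.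
Definition betaO (i : 'I_n) : Omega_ch U := gen (GBeta U i).
Definition bO (i : 'I_n) : Omega_ch U := gen (GB U i).
Definition cO (i : 'I_n) : Omega_ch U := gen (GC U i).

Definition Qfield : Omega_ch U := \sum_i betaO i ∙ cO i.

Definition Dch (x : Omega_ch U) : Omega_ch U := Qfield ∘_(0) x.

(* The subspaces [has_weight w] form the conformal weight grading. *)
Inductive has_weight : int -> Omega_ch U -> Prop :=
  | hw_gen g : has_weight (gwt g) (gen g)
  | hw_vac : has_weight 0 vac
  | hw_zero w : has_weight w 0
  | hw_add w x y : has_weight w x -> has_weight w y -> has_weight w (x + y)
  | hw_scale w k x : has_weight w x -> has_weight w (k *: x)
  | hw_prod w w' m x y : has_weight w x -> has_weight w' y ->
      has_weight (w + w' - m - 1) (x ∘_(m) y).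

(* A differential form is given by its coefficients: [eta I] is the coefficient
   of the wedge product of the d gamma^i, for i in I in increasing order. *)
Definition localform := {set 'I_n} -> 'rV[R]_n -> C.

Definition dform (eta : localform) : localform := fun K x =>
  \sum_(i in K) (-1) ^+ #|[set j in K | (j < i)%N]| * cpartial i (eta (K :\ i)) x.

Definition wedge (eta theta : localform) : localform := fun K x =>
  \sum_(I : {set 'I_n} | I \subset K)
    (-1) ^+ #|[set p in finset.setX I (K :\: I) | (p.2 < p.1)%N]|
    * eta I x * theta (K :\: I) x.

Definition iota_ch (eta : localform) : Omega_ch U :=
  \sum_(I : {set 'I_n}) fnO (eta I) ∙ foldr (fun i x => cO i ∙ x) vac (enum I).

End LocalOps.

Section Transition.
Variables (R : realType) (n : nat) (U V W : set 'rV[R]_n).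
Local Notation C := (R[i]).

(* The restriction of the generators over [U] to [W], for [W] inside [U]. *)
Definition res_gen (x : chgen U) : Omega_ch W :=
  match x with
  | GFun h => fnO W (sval h)
  | GBeta i => betaO W i
  | GB i => bO W i
  | GC i => cO W i
  end.

(* The generators over [V], in the coordinates [g gamma], expressed over [W] in
   the coordinates [gamma]; [f] is the inverse of [g]. *)
Definition trans_gen (g f : 'rV[R]_n -> 'rV[R]_n) (x : chgen V) : Omega_ch W :=
  let F i j := cplx (partial i (comp_ f j) \o g) in
  match x with
  | GFun h => fnO W (sval h \o g)
  | GC i => \sum_j fnO W (cplx (partial j (comp_ g i))) ∙ cO W j
  | GB i => \sum_j fnO W (F i j) ∙ bO W j
  | GBeta i => \sum_j betaO W j ∙ fnO W (F i j)
      + \sum_k \sum_l \sum_r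
          fnO W (cplx (fun x => partial i (partial l (comp_ f k)) (g x)
                                * partial r (comp_ g l) x))
          ∙ cO W r ∙ bO W k
  end.

(* The graph of the gluing map: writing [s'] as an expression in the generators
   over [V] and changing coordinates gives [s] restricted to [W].  The choice of
   the expressions is immaterial, since [trans_gen] satisfies the relations of
   Omega_ch(V) when [g] is a diffeomorphism with inverse [f]. *)
Definition glued (g f : 'rV[R]_n -> 'rV[R]_n) (s : Omega_ch U) (s' : Omega_ch V) :=
  exists (t : chterm U) (t' : chterm V),
    [/\ s = ev (@gen R n U) t, s' = ev (@gen R n V) t' &
        ev res_gen t = ev (trans_gen g f) t'].

End Transition.

(* Forms and global sections are described by their expressions in the charts;
   by the sheaf property any atlas of the smooth structure will do. *)
Record smooth_atlas (R : realType) (n : nat) (Z : topologicalType) := SmoothAtlas {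
  chart_idx : Type;
  chart_dom : chart_idx -> set Z;
  chart : chart_idx -> Z -> 'rV[R]_n;
  chart_inv : chart_idx -> 'rV[R]_n -> Z;
  chart_dom_open : forall a, open (chart_dom a);
  chart_img_open : forall a, open (chart a @` chart_dom a);
  chart_cover : forall z, exists a, chart_dom a z;
  chartK : forall a z, chart_dom a z -> chart_inv a (chart a z) = z;
  chart_cont : forall a z, chart_dom a z -> {for z, continuous (chart a)};
  chart_inv_cont : forall a z, chart_dom a z ->
    {for chart a z, continuous (chart_inv a)};
  chart_smooth : forall a b i,
    rsmooth (chart a @` (chart_dom a `&` chart_dom b))
            (comp_ (chart b \o chart_inv a) i)
}.

Section Global.
Variables (R : realType) (n : nat) (Z : topologicalType) (A : smooth_atlas R n Z).
Local Notation C := (R[i]).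
Implicit Types a b : chart_idx A.

Definition img a : set 'rV[R]_n := chart a @` chart_dom a.
Definition overlap a b : set 'rV[R]_n := chart a @` (chart_dom a `&` chart_dom b).
Definition tr a b : 'rV[R]_n -> 'rV[R]_n := chart b \o chart_inv a.

(* Global sections, and the operators on them, live in the product over the
   charts. *)
Definition chfam := forall a, Omega_ch (img a).

Definition compatible (s : chfam) : Prop :=
  forall a b, glued (overlap a b) (tr a b) (tr b a) (s a) (s b).

(* Each conformal weight component is an ordinary sheaf, and a global section is
   a finite sum of homogeneous ones. *)
Definition homog_section (w : int) (s : chfam) : Prop :=
  compatible s /\ forall a, has_weight w (s a).

Definition global_section (s : chfam) : Prop :=
  exists (N : nat) (t : nat -> chfam),
    (forall w : nat, homog_section w%:Z (t w))
    /\ forall a, s a = \sum_(w < N) t w a.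

Definition formfam := chart_idx A -> localform R n.

Definition pullback (g : 'rV[R]_n -> 'rV[R]_n) (eta : localform R n) :
    localform R n := fun I x =>
  \sum_(J : {set 'I_n} | #|J| == #|I|)
    eta J (g x) *
    (\det (\matrix_(r < #|I|, s < #|I|)
       nth 0 [seq partial (enum_val r) (comp_ g j) x | j <- enum J] s))%:C%C.

Definition is_form (eta : formfam) : Prop :=
  (forall a I, csmooth (img a) (eta a I)) /\
  (forall a b I x, overlap a b x -> eta a I x = pullback (tr a b) (eta b) I x).

Definition of_degree (p : nat) (eta : formfam) : Prop :=
  forall a (I : {set 'I_n}) x, img a x -> #|I| != p -> eta a I x = 0.

Definition closed_form (eta : formfam) : Prop :=
  forall a I x, img a x -> dform (eta a) I x = 0.

Definition d_tw (H eta : formfam) : formfam := fun a I x =>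
  dform (eta a) I x + wedge (H a) (eta a) I x.

Definition iota_form (eta : formfam) : chfam := fun a => iota_ch (img a) (eta a).

Definition D_tw (H : formfam) (s : chfam) : chfam := fun a =>
  Dch (s a) + iota_form H a ∙ s a.

End Global.

(* Main.v *)
Require Import Defs.
From mathcomp Require Import all_boot all_order all_algebra.
From mathcomp Require Import generic_quotient zify ring.
From mathcomp Require Import all_classical all_reals all_analysis.
From mathcomp Require Import complex.

(* The zero mode [D] of [Q] is an odd derivation of all products, it restricts to
   the de Rham differential on forms, and [D^2 = 0] because [Q_(0) Q = 0].  As [H]
   is odd and [H_(n) H = 0] for [n >= 0], also [H_(-1) H_(-1) = 0], and
   [D_H^2 = 0] follows from [D H = 0].

   The real work is to see that [D_H] respects the gluing, that is, that the zero
   mode of [Q] does not depend on the coordinates.  One has [Q = D (sum b^i c^i)].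
   For the new fields [b~], [c~], [beta~] one finds [D b~ = beta~], because the
   quantum corrections cancel, and [D c~ = 0], hence [Q~ = D (sum b~^i c~^i)].  Now
   [sum b~^i c~^i - sum b^i c^i] is the 1-form [tr (dF G)], where [G] is the
   Jacobian matrix and [F] its inverse.  This form is closed, so its zero mode
   vanishes, and then so does that of its image under [D], being a commutator with
   the zero mode of [Q].  No OPE between the new fields is needed. *)

Set Implicit Arguments.
Unset Strict Implicit.
Unset Printing Implicit Defensive.

Import Order.TTheory GRing.Theory Num.Theory.
Import numFieldNormedType.Exports.

Local Open Scope classical_set_scope.
Local Open Scope ring_scope.

(** * Sums over subsets of an ordinal and minors *)

(** Gluing is a relation between expressions, and evaluation commutes with products. So it suffices
    to evaluate one expression for [Q] and one for [H] in the transformed generators. For [H] this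
    is classical: functions and the fields [c] have regular OPEs, so a word in the [c~] expands into
    minors of the Jacobian as a product of 1-forms does.

    A direct comparison of [Q~] with [Q] would have to expand triple products containing second
    derivatives. Writing both as images under [D] leaves one contraction, of [b^j] with [c^j], and
    this is the origin of [tr (dF G)]. The form is closed because [dF = - F dG F]: up to sign its
    differential is the trace of [F dG F dG], which vanishes by cyclicity, as 1-forms anticommute.
    Its zero mode is a derivation of all products, hence determined by the generators. It kills all
    of them except possibly the [beta^m], and it sends [beta^m] to a contraction of the differential
    of the form. *)

Lemma exchange_big4 (T : nmodType) (I J : finType) (F : I -> I -> J -> J -> T) :
  \sum_c \sum_d \sum_a \sum_b F a b c d = \sum_a \sum_b \sum_c \sum_d F a b c d.
Proof.
transitivity (\sum_(p : J * J) \sum_(q : I * I) F q.1 q.2 p.1 p.2).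
  rewrite (pair_bigA _ (fun c d => \sum_a \sum_b F a b c d)) /=.
  by apply: eq_bigr => p _; rewrite (pair_bigA _ (fun a b => F a b p.1 p.2)).
rewrite exchange_big (pair_bigA _ (fun a b => \sum_c \sum_d F a b c d)) /=.
by apply: eq_bigr => p _; rewrite (pair_bigA _ (fun c d => F p.1 p.2 c d)).
Qed.

Lemma sum_delta (A : pzSemiRingType) (I : finType) (F : I -> A) i :
  \sum_j F j * (j == i)%:R = F i.
Proof.
rewrite (bigD1 i) //= eqxx mulr1 big1 ?addr0 // => j /negbTE ->.
by rewrite mulr0.
Qed.

Section OrdinalSets.
Variable n : nat.
Implicit Types (i j : 'I_n).

Local Open Scope nat_scope.
Lemma enum_sorted (I : {set 'I_n}) : sorted ltn (map val (enum I)).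
Proof.
have -> : enum I = [seq i <- enum 'I_n | i \in I] by rewrite enumT.
apply: (subseq_sorted ltn_trans) (iota_ltn_sorted 0 n).
rewrite -val_enum_ord; apply: map_subseq; exact: filter_subseq.
Qed.
Local Close Scope nat_scope.

(** Its size is the number of transpositions that take [i] from the front of the word of [I] to its
    place, hence a sign exponent. *)
Definition below (i : 'I_n) (I : {set 'I_n}) := [set j in I | (j < i)%N].

Local Notation olt := (fun a b : 'I_n => (a < b)%N).

Lemma olt_trans : transitive olt.
Proof. by move=> ? ? ?; apply: ltn_trans. Qed.

Lemma sorted_enum (I : {set 'I_n}) (s : seq 'I_n) : sorted olt s -> s =i I -> s = enum I.
Proof.
move=> ss sI; apply: (irr_sorted_eq olt_trans) => //; first by move=> a; apply: ltnn.
  by have := enum_sorted I; rewrite sorted_map.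
by move=> a; rewrite mem_enum.
Qed.

(** The list [m] will be [[::]] or [[:: i]], so that the enumerations of a set without [i] and of
    the set with [i] added are handled together. *)
Lemma sorted_low_high i (I : {set 'I_n}) (m : seq 'I_n) :
  sorted olt m -> (forall j, j \in m -> j = i) ->
  sorted olt ([seq j : 'I_n <- enum I | (j < i)%N] ++ m
    ++ [seq j : 'I_n <- enum I | (i < j)%N]).
Proof.
move=> sm mi.
have se (Q : pred 'I_n) : sorted olt [seq j <- enum I | Q j].
  apply: sorted_filter; first exact: olt_trans.
  by have := enum_sorted I; rewrite sorted_map.
rewrite (sorted_pairwise olt_trans) !pairwise_cat -!(sorted_pairwise olt_trans).
rewrite sm !se !andbT; apply/andP; split; apply/allrelP => a b.
  rewrite mem_filter mem_cat => /andP[ai _] /orP[/mi->//|].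
  by rewrite mem_filter => /andP[ib _]; apply: ltn_trans ib.
by move=> /mi ->; rewrite mem_filter => /andP[].
Qed.

Lemma mem_filter_enum (P : pred 'I_n) (I : {set 'I_n}) j :
  (j \in [seq j <- enum I | P j]) = P j && (j \in I).
Proof. by rewrite mem_filter mem_enum. Qed.

Lemma enum_split i (I : {set 'I_n}) : i \notin I ->
  enum I = [seq j : 'I_n <- enum I | (j < i)%N] ++ [seq j : 'I_n <- enum I | (i < j)%N].
Proof.
move=> iI; apply/esym/sorted_enum; first exact: (@sorted_low_high i I [::]).
move=> j; rewrite mem_cat !mem_filter_enum -andb_orl.
case: (ltngtP j i) => //= /val_inj ->; exact/esym/negbTE.
Qed.

Lemma enum_setU1 i (I : {set 'I_n}) :
  enum (i |: I) = [seq j : 'I_n <- enum I | (j < i)%N]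
    ++ i :: [seq j : 'I_n <- enum I | (i < j)%N].
Proof.
apply/esym/sorted_enum.
  by apply: (@sorted_low_high i I [:: i]) => // j; rewrite inE => /eqP.
move=> j; rewrite mem_cat in_cons !mem_filter_enum !inE.
by case: (ltngtP j i) => [_|_|/val_inj ->]; rewrite ?eqxx ?orbT //= ?orbF //; rewrite orbC.
Qed.

(** This turns the sum over [I] and [i] that arises when a factor [i] is multiplied onto the word of
    [I] into the sum over [K] and [i] of [dform] and of the Laplace expansion. *)
Lemma sum_setU1 (T : zmodType) (F : {set 'I_n} -> {set 'I_n} -> T) i :
  \sum_(I : {set 'I_n} | i \notin I) F I (i |: I)
  = \sum_(K : {set 'I_n} | i \in K) F (K :\ i) K.
Proof.
rewrite (reindex_onto (fun K : {set 'I_n} => K :\ i)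
  (fun I : {set 'I_n} => i |: I)) /=; last first.
  by move=> I iI; rewrite setU1K.
apply: eq_big => [K|K /andP[_ /eqP->]] //.
rewrite setD11 /=; apply/eqP/idP => [<-|iK]; first exact: setU11.
exact: finset.setD1K.
Qed.

(** The sign exponent of the shuffle that merges [I] and [J]. A sum over [I] suits induction on [I],
    and [card_inversions] matches it with the sign in [wedge]. *)
Definition inversions (I J : {set 'I_n}) := (\sum_(i in I) #|below i J|)%N.

Lemma card_inversions (I J : {set 'I_n}) :
  #|[set p in finset.setX I J | (p.2 < p.1)%N]|%N = inversions I J.
Proof.
rewrite /inversions -sum1_card.
under [RHS]eq_bigr do rewrite -sum1_card.
rewrite pair_big_dep /=; apply: eq_bigl => -[i j]; by rewrite !inE /= andbA.
Qed.

End OrdinalSets.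

(** * Minors and the Laplace expansion *)

Section Minor.
Variables (A : comPzRingType) (n : nat) (g : 'I_n -> 'I_n -> A).
Implicit Types (i j : 'I_n) (s t : seq 'I_n).

(* The rows are indexed by [t] and the columns by [s].  Nesting [nth] avoids a
   default element of ['I_n], which may be empty. *)
Definition minor (p : nat) t s : A := \det (\matrix_(r < p, q < p)
  nth 0 (nth [::] [seq [seq g j i | j <- s] | i <- t] r) q).

Lemma nth_map_cons (T : Type) (a : T -> A) (b : T -> seq A) (u : seq T) q r :
  nth 0 (nth [::] [seq a k :: b k | k <- u] r) q.+1 = nth 0 (nth [::] [seq b k | k <- u] r) q.
Proof. by elim: u r => [|i u IH] [|r] //=; rewrite nth_nil. Qed.

(** Laplace expansion along the first column. The row of [i] is its position in [enum K], that is,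
    the number of elements of [K] below [i], so the cofactor signs are those of the exterior
    algebra. *)
Lemma minor_cons p j s (K : {set 'I_n}) : #|K| = p.+1 ->
  minor p.+1 (enum K) (j :: s)
  = \sum_(i in K) (-1) ^+ #|below i (K :\ i)| * (g j i * minor p (enum (K :\ i)) s).
Proof.
move=> cK; rewrite /minor (expand_det_col _ 0) -[RHS]big_enum /=.
have [i0 _] : exists i, i \in K by apply/card_gt0P; rewrite cK.
rewrite (big_nth i0) -cardE cK big_mkord; apply: eq_bigr => r _.
set i := nth i0 (enum K) r.
have rK : (r < size (enum K))%N by rewrite -cardE cK.
have iK : i \in K by rewrite -mem_enum mem_nth.
pose low := [seq k : 'I_n <- enum (K :\ i) | (k < i)%N].
pose high := [seq k : 'I_n <- enum (K :\ i) | (i < k)%N].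
have eK : enum K = low ++ i :: high.
  by rewrite -[in LHS](finset.setD1K iK) enum_setU1.
have eK' : enum (K :\ i) = low ++ high by apply: enum_split; rewrite !inE eqxx.
have er : size low = r :> nat.
  rewrite -(index_uniq i0 rK (enum_uniq _)) -/i eK index_cat ifF /= ?eqxx ?addn0 //.
  by rewrite mem_filter ltnn.
have eb : #|below i (K :\ i)| = r.
  rewrite -er cardE; congr size; apply/esym/sorted_enum; last first.
    by move=> k; rewrite mem_filter_enum !inE andbC.
  apply: sorted_filter; first exact: olt_trans.
  by have := enum_sorted (K :\ i); rewrite sorted_map.
rewrite !mxE (nth_map i0) //= -/i mulrCA /cofactor addn0 eb.
congr (_ * (_ * \det _)); apply/matrixP => a b; rewrite !mxE /=.
rewrite /bump leq0n add1n nth_map_cons eK eK' !map_cat /= !nth_cat !size_map er.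
case: (leqP r a) => ra; first by rewrite ltnNge (leq_trans ra) //= subSn.
by rewrite add0n ra.
Qed.

Lemma minor_enum (I : {set 'I_n}) s : minor #|I| (enum I) s
  = \det (\matrix_(r < #|I|, q < #|I|) nth 0 [seq g j (enum_val r) | j <- s] q).
Proof.
congr (\det _); apply/matrixP => r q; rewrite !mxE (nth_map (enum_val r)) -?cardE //.
by rewrite -enum_val_nth.
Qed.

End Minor.

(** * Smooth functions *)

(** Functions are total, but the identities between them hold only on open sets. The affine
    expansion of [f] at [x] is also one of [g], as the two agree near [x]. *)
Lemma near_eq_differentiable (R : numFieldType) (V W : normedModType R)
    (f g : V -> W) (x : V) :
  (\near x, f x = g x) -> differentiable f x -> differentiable g x.
Proof.
move=> fg /diff_locallyP[dc df]; have gx := nbhs_singleton fg.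
have dg : g \o shift x = cst (g x) + 'd f x +o_ 0 id.
  apply/eqaddoP => e e0; move/eqaddoP: df => /(_ _ e0).
  rewrite (near_shift 0) in fg.
  apply: filterS2 fg => y /=; rewrite subr0 !fctE /= => fg.
  by rewrite -fg gx.
by apply/diff_locallyP; rewrite (diff_unique dc dg).
Qed.

Section Smooth.
Variables (R : realType) (n : nat).
Local Notation E := 'rV[R]_n.
Implicit Types (W : set E) (f g : E -> R).

Lemma partial_eq W f g i : open W -> {in W, f =1 g} ->
  {in W, partial i f =1 partial i g}.
Proof.
move=> oW fg x /set_mem Wx; rewrite /partial; case: (eqVneq (delta_mx 0 i : E) 0) => [->|nz].
  by rewrite !derive0.
apply: near_eq_derive => //.
by near=> y; apply: fg; apply: mem_set; near: y; apply: open_nbhs_nbhs.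
Unshelve. all: by end_near. Qed.

Lemma partialD f g i x : differentiable f x -> differentiable g x ->
  partial i (fun y => f y + g y) x = partial i f x + partial i g x.
Proof. by move=> df dg; apply: deriveD; apply: diff_derivable. Qed.

Lemma partialM f g i x : differentiable f x -> differentiable g x ->
  partial i (fun y => f y * g y) x = partial i f x * g x + f x * partial i g x.
Proof.
move=> df dg; rewrite /partial deriveM; try exact: diff_derivable.
by rewrite addrC [g x *: _]mulrC.
Qed.

Lemma partial_cst (c : R) i x : partial i (fun _ : E => c) x = 0.
Proof. exact: derive_cst. Qed.

Lemma differentiable_comp_ (g : E -> E) x :
  (forall l, differentiable (comp_ g l) x) -> differentiable g x.
Proof.
move=> dg.
have -> : g = \sum_l (fun y => comp_ g l y *: (delta_mx 0 l : E)).
  apply/funext => y; rewrite fct_sumE [LHS]matrix_sum_delta big_ord1.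
  by apply: eq_bigr.
by apply: differentiable_sum => l; apply: differentiableZl.
Qed.

Lemma partial_chain f (g : E -> E) r x :
  (forall l, differentiable (comp_ g l) x) -> differentiable f (g x) ->
  partial r (f \o g) x = \sum_l partial l f (g x) * partial r (comp_ g l) x.
Proof.
move=> dg df.
have dg' := differentiable_comp_ dg.
rewrite /partial deriveE; last exact: differentiable_comp.
rewrite diff_comp //= -(deriveE (delta_mx 0 r) dg').
rewrite derive_mx; last exact: diff_derivable.
rewrite [X in 'd f _ X]matrix_sum_delta big_ord1 linear_sum.
apply: eq_bigr => l _; rewrite linearZ /= mxE mulrC -deriveE //.
Qed.

Lemma partial_sum (I : Type) (r : seq I) (P : pred I) (F : I -> E -> R) i x :
  (forall k, differentiable (F k) x) ->
  partial i (fun y => \sum_(k <- r | P k) F k y) x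
  = \sum_(k <- r | P k) partial i (F k) x.
Proof.
move=> dF.
suff [_ //] : differentiable (fun y => \sum_(k <- r | P k) F k y) x /\
  partial i (fun y => \sum_(k <- r | P k) F k y) x
  = \sum_(k <- r | P k) partial i (F k) x.
elim: r => [|k r [IHd IH]].
  under eq_fun do rewrite big_nil.
  by rewrite big_nil partial_cst; split=> //; apply: differentiable_cst.
rewrite big_cons; under eq_fun do rewrite big_cons.
case: (P k) => //; split; last by rewrite partialD // IH.
exact: differentiableD.
Qed.

(* Products and compositions are treated by induction on the order [k]. *)
Definition ksmooth W (k : nat) f :=
  forall (s : seq 'I_n) x, (size s <= k)%N -> W x ->
    differentiable (foldr (@partial R n) f s) x.

Lemma rsmoothP W f : rsmooth W f <-> forall k, ksmooth W k f.
Proof.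
split=> [h k s x _|h s x]; first exact: h.
exact: (h (size s)).
Qed.

Lemma ksmooth_diff W k f x : ksmooth W k f -> W x -> differentiable f x.
Proof. by move=> h; apply: (h [::]). Qed.

(** The innermost derivative is split off, so that in an induction on [k] the Leibniz and chain
    rules are applied to the function itself and the induction hypothesis to its first
    derivatives. *)
Lemma ksmoothS W k f : ksmooth W k.+1 f <->
  (forall x, W x -> differentiable f x) /\ forall i, ksmooth W k (partial i f).
Proof.
split=> [h|[h0 h1] s x].
  split=> [x|i s x hs Wx]; first exact: ksmooth_diff h.
  by rewrite -foldr_rcons; apply: h => //; rewrite size_rcons.
case/lastP: s => [|s i]; first by move=> _; apply: h0.
by rewrite size_rcons foldr_rcons; apply: h1.
Qed.

Lemma ksmoothW W k f : ksmooth W k.+1 f -> ksmooth W k f.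
Proof. by move=> h s x hs; apply: h; apply: leq_trans hs _. Qed.

Lemma rsmooth_diff W f x : rsmooth W f -> W x -> differentiable f x.
Proof. by move=> h; apply: (h [::]). Qed.

Lemma rsmooth_partial W f i : rsmooth W f -> rsmooth W (partial i f).
Proof. by move=> h s x; rewrite -foldr_rcons; apply: h. Qed.

Lemma rsmooth_sub W W' f : W' `<=` W -> rsmooth W f -> rsmooth W' f.
Proof. by move=> sW h s x /sW; apply: h. Qed.

Lemma near_in W f g x : open W -> W x -> {in W, f =1 g} -> \near x, f x = g x.
Proof.
move=> oW Wx fg; apply: filterS (open_nbhs_nbhs (conj oW Wx)) => y Wy.
by apply: fg; apply: mem_set.
Qed.

Lemma ksmooth_eq W k f g : open W -> {in W, f =1 g} ->
  ksmooth W k f -> ksmooth W k g.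
Proof.
move=> oW; elim: k => [|k IH] in f g * => fg h.
  move=> s x; case: s => // _ Wx.
  apply: near_eq_differentiable (ksmooth_diff h Wx); exact: near_in fg.
have [h0 h1] := (ksmoothS _ _ _).1 h; apply/ksmoothS; split=> [x Wx|i].
  apply: near_eq_differentiable (h0 _ Wx); exact: near_in fg.
by apply: IH (h1 i); apply: partial_eq.
Qed.

Lemma rsmooth_eq W f g : open W -> {in W, f =1 g} -> rsmooth W f -> rsmooth W g.
Proof.
by move=> oW fg /rsmoothP h; apply/rsmoothP => k; apply: ksmooth_eq (h k).
Qed.

Lemma ksmooth_cst W k (c : R) : ksmooth W k (fun=> c).
Proof.
elim: k c => [|k IH] c.
  by move=> [|//] x _ _; apply: differentiable_cst.
apply/ksmoothS; split=> [x _|i]; first exact: differentiable_cst.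
have -> : partial i (fun _ : E => c) = fun=> 0; last exact: IH.
by apply/funext => x; rewrite partial_cst.
Qed.

Lemma ksmoothD W k f g : open W -> ksmooth W k f -> ksmooth W k g ->
  ksmooth W k (fun x => f x + g x).
Proof.
move=> oW; elim: k => [|k IH] in f g *.
  by move=> hf hg [|//] x _ Wx /=; apply: differentiableD;
    [apply: ksmooth_diff hf Wx | apply: ksmooth_diff hg Wx].
move=> /ksmoothS[df hf] /ksmoothS[dg hg]; apply/ksmoothS; split=> [x Wx|i].
  by apply: differentiableD; [apply: df | apply: dg].
apply: (ksmooth_eq oW _ (IH _ _ (hf i) (hg i))) => x /set_mem Wx.
by rewrite partialD //; [apply: df | apply: dg].
Qed.

Lemma ksmoothM W k f g : open W -> ksmooth W k f -> ksmooth W k g ->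
  ksmooth W k (fun x => f x * g x).
Proof.
move=> oW; elim: k => [|k IH] in f g *.
  by move=> hf hg [|//] x _ Wx /=; apply: differentiableM;
    [apply: ksmooth_diff hf Wx | apply: ksmooth_diff hg Wx].
move=> kf kg; have [[df hf] [dg hg]] := ((ksmoothS _ _ _).1 kf, (ksmoothS _ _ _).1 kg).
apply/ksmoothS; split=> [x Wx|i].
  by apply: differentiableM; [apply: df | apply: dg].
apply: (ksmooth_eq oW _ (ksmoothD oW (IH _ _ (hf i) (ksmoothW kg))
  (IH _ _ (ksmoothW kf) (hg i)))) => x /set_mem Wx.
by rewrite partialM //; [apply: df | apply: dg].
Qed.

Lemma ksmooth_sum W k (I : Type) (r : seq I) (P : pred I) (F : I -> E -> R) :
  open W -> (forall i, ksmooth W k (F i)) ->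
  ksmooth W k (fun x => \sum_(i <- r | P i) F i x).
Proof.
move=> oW hF; elim: r => [|i r IH].
  by under eq_fun do rewrite big_nil; apply: ksmooth_cst.
by under eq_fun do rewrite big_cons; case: (P i) => //; apply: ksmoothD.
Qed.

Lemma ksmooth_comp W W' k f (g : E -> E) : open W ->
  (forall x, W x -> W' (g x)) ->
  ksmooth W' k f -> (forall l, ksmooth W k (comp_ g l)) -> ksmooth W k (f \o g).
Proof.
move=> oW gW; elim: k => [|k IH] in f *.
  move=> hf hg [|//] x _ Wx; apply: differentiable_comp.
    by apply: differentiable_comp_ => // l; apply: ksmooth_diff (hg l) Wx.
  by apply: (ksmooth_diff hf); apply: gW.
move=> /ksmoothS[df hf] hg; apply/ksmoothS; split=> [x Wx|i].
  apply: differentiable_comp; last by apply: df; apply: gW.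
  by apply: differentiable_comp_ => // l; apply: ksmooth_diff (hg l) Wx.
have h := ksmooth_sum (index_enum _) xpredT oW (fun l =>
  ksmoothM oW (IH _ (hf l) (fun l => ksmoothW (hg l)))
    (((ksmoothS _ _ _).1 (hg l)).2 i)).
apply: (ksmooth_eq oW _ h) => x /set_mem Wx.
rewrite partial_chain //; last by apply: df; apply: gW.
by move=> l; apply: ksmooth_diff (hg l) Wx.
Qed.

Lemma rsmooth_cst W (c : R) : rsmooth W (fun=> c).
Proof. by apply/rsmoothP => k; apply: ksmooth_cst. Qed.

Lemma rsmoothD W f g : open W -> rsmooth W f -> rsmooth W g ->
  rsmooth W (fun x => f x + g x).
Proof.
by move=> oW /rsmoothP hf /rsmoothP hg; apply/rsmoothP => k; apply: ksmoothD.
Qed.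

Lemma rsmoothM W f g : open W -> rsmooth W f -> rsmooth W g ->
  rsmooth W (fun x => f x * g x).
Proof.
by move=> oW /rsmoothP hf /rsmoothP hg; apply/rsmoothP => k; apply: ksmoothM.
Qed.

Lemma rsmoothN W f : open W -> rsmooth W f -> rsmooth W (fun x => - f x).
Proof.
move=> oW hf; under eq_fun do rewrite -mulN1r.
by apply: rsmoothM => //; apply: rsmooth_cst.
Qed.

Lemma rsmooth_sum W (I : Type) (r : seq I) (P : pred I) (F : I -> E -> R) :
  open W -> (forall i, rsmooth W (F i)) -> rsmooth W (fun x => \sum_(i <- r | P i) F i x).
Proof.
move=> oW hF; elim: r => [|i r IH].
  by under eq_fun do rewrite big_nil; apply: rsmooth_cst.
by under eq_fun do rewrite big_cons; case: (P i) => //; apply: rsmoothD.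
Qed.

Lemma rsmooth_prod W (I : Type) (r : seq I) (P : pred I) (F : I -> E -> R) :
  open W -> (forall i, rsmooth W (F i)) -> rsmooth W (fun x => \prod_(i <- r | P i) F i x).
Proof.
move=> oW hF; elim: r => [|i r IH].
  by under eq_fun do rewrite big_nil; apply: rsmooth_cst.
by under eq_fun do rewrite big_cons; case: (P i) => //; apply: rsmoothM.
Qed.

Lemma rsmooth_minor W (g : 'I_n -> 'I_n -> E -> R) p t s : open W ->
  (forall i j, rsmooth W (g i j)) -> rsmooth W (fun x => minor (fun i j => g i j x) p t s).
Proof.
move=> oW sg; apply: rsmooth_sum => // u; apply: rsmoothM => //; first exact: rsmooth_cst.
apply: rsmooth_prod => // r; under eq_fun do rewrite mxE.
move: (nat_of_ord (perm.fun_of_perm u r)) => q; move: (nat_of_ord r) => k.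
(* Out of the range of either list the entry is the constant 0. *)
elim: t k => [|i t IH] [|k] /=; rewrite ?nth_nil; try exact: IH;
  try exact: rsmooth_cst.
by elim: s q {IH} => [|j s IHs] [|q] /=;
  [exact: rsmooth_cst | exact: rsmooth_cst | exact: sg | exact: IHs].
Qed.

Lemma rsmooth_comp W W' f (g : E -> E) : open W ->
  (forall x, W x -> W' (g x)) ->
  rsmooth W' f -> (forall l, rsmooth W (comp_ g l)) -> rsmooth W (f \o g).
Proof.
move=> oW gW /rsmoothP hf hg; apply/rsmoothP => k.
by apply: ksmooth_comp gW (hf k) _ => // l; apply: (rsmoothP _ _).1.
Qed.

End Smooth.

(** * Smooth complex-valued functions *)

Section ComplexSmooth.
Variables (R : realType) (n : nat).
Local Notation E := 'rV[R]_n.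
Local Notation C := (R[i]).
Implicit Types (W : set E) (f g : E -> C).

Lemma csmooth_sub W W' f : W' `<=` W -> csmooth W f -> csmooth W' f.
Proof. by move=> s [h1 h2]; split; apply: rsmooth_sub s _. Qed.

Lemma csmooth_eq W f g : open W -> {in W, f =1 g} -> csmooth W f -> csmooth W g.
Proof.
by move=> oW fg [h1 h2]; split; [apply: rsmooth_eq h1 | apply: rsmooth_eq h2];
  rewrite // => x Wx; rewrite /Ref /Imf fg.
Qed.

Lemma csmooth_cpartial W f i : csmooth W f -> csmooth W (cpartial i f).
Proof. by move=> [h1 h2]; split; apply: rsmooth_partial. Qed.

Lemma csmooth_cst W (c : C) : csmooth W (fun=> c).
Proof. by split; apply: rsmooth_cst. Qed.

Lemma csmooth_cplx W (f : E -> R) : rsmooth W f -> csmooth W (cplx f).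
Proof. by move=> h; split=> //; apply: rsmooth_cst. Qed.

Lemma csmoothD W f g : open W -> csmooth W f -> csmooth W g ->
  csmooth W (fun x => f x + g x).
Proof.
move=> oW [f1 f2] [g1 g2]; split.
  have -> : Ref (fun x => f x + g x) = fun x => Ref f x + Ref g x.
    by apply/funext => x; rewrite /Ref; case: (f x) (g x) => ? ? [].
  exact: rsmoothD.
have -> : Imf (fun x => f x + g x) = fun x => Imf f x + Imf g x.
  by apply/funext => x; rewrite /Imf; case: (f x) (g x) => ? ? [].
exact: rsmoothD.
Qed.

Lemma csmoothM W f g : open W -> csmooth W f -> csmooth W g ->
  csmooth W (fun x => f x * g x).
Proof.
move=> oW [f1 f2] [g1 g2]; split.
  have -> : Ref (fun x => f x * g x)
      = fun x => Ref f x * Ref g x + - (Imf f x * Imf g x).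
    by apply/funext => x; rewrite /Ref /Imf; case: (f x) (g x) => ? ? [].
  by apply: rsmoothD => //; [|apply: rsmoothN => //]; apply: rsmoothM.
have -> : Imf (fun x => f x * g x) = fun x => Ref f x * Imf g x + Imf f x * Ref g x.
  by apply/funext => x; rewrite /Ref /Imf; case: (f x) (g x) => ? ? [].
by apply: rsmoothD => //; apply: rsmoothM.
Qed.

Lemma csmoothZ W (c : C) f : open W -> csmooth W f -> csmooth W (fun x => c * f x).
Proof. by move=> oW; apply: csmoothM => //; apply: csmooth_cst. Qed.

Lemma csmooth_sum W (I : Type) (r : seq I) (P : pred I) (F : I -> E -> C) :
  open W -> (forall i, csmooth W (F i)) -> csmooth W (fun x => \sum_(i <- r | P i) F i x).
Proof.
move=> oW hF; elim: r => [|i r IH].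
  by under eq_fun do rewrite big_nil; apply: csmooth_cst.
by under eq_fun do rewrite big_cons; case: (P i) => //; apply: csmoothD.
Qed.

Lemma csmooth_comp W W' f (g : E -> E) : open W ->
  (forall x, W x -> W' (g x)) ->
  csmooth W' f -> (forall l, rsmooth W (comp_ g l)) -> csmooth W (f \o g).
Proof.
move=> oW gW [h1 h2] hg; split.
  exact: (rsmooth_comp oW gW h1 hg).
exact: (rsmooth_comp oW gW h2 hg).
Qed.

Lemma cpartial_cplx i (f : E -> R) : cpartial i (cplx f) = cplx (partial i f).
Proof.
apply/funext => x; rewrite /cpartial /cplx; congr Complex.
by rewrite -[RHS](partial_cst 0 i x).
Qed.

End ComplexSmooth.

(** * Vertex superalgebras *)

Section VertexAlgebra.
Variables (K : fieldType) (V : vertexSuperalgebra K).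
Implicit Types (a b c x y : V) (m n k : int) (p q : bool).

Lemma nprodNr n a b : a ∘_(n) (- b) = - (a ∘_(n) b).
Proof. by rewrite -scaleN1r nprodZr scaleN1r. Qed.

Lemma nprod_suml n (I : Type) (r : seq I) (P : pred I) (F : I -> V) b :
  (\sum_(i <- r | P i) F i) ∘_(n) b = \sum_(i <- r | P i) F i ∘_(n) b.
Proof.
exact: (big_morph (fun a => a ∘_(n) b) (fun x y => nprodDl n x y b) (nprod0l n b)).
Qed.

Lemma nprod_sumr n (I : Type) (r : seq I) (P : pred I) (F : I -> V) a :
  a ∘_(n) (\sum_(i <- r | P i) F i) = \sum_(i <- r | P i) a ∘_(n) F i.
Proof.
exact: (big_morph (fun b => a ∘_(n) b) (fun x y => nprodDr n x y a) (nprod0r n a)).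
Qed.

Lemma par_add p x y : par p x -> par p y -> par p (x + y).
Proof. by move=> hx hy; rewrite -[x]scale1r; apply: par_lin. Qed.

Lemma par_sum p (I : Type) (r : seq I) (P : pred I) (F : I -> V) :
  (forall i, P i -> par p (F i)) -> par p (\sum_(i <- r | P i) F i).
Proof.
move=> hF; elim/big_rec: _ => [|i x Pi]; first exact: par_zero.
by apply: par_add; apply: hF.
Qed.

Lemma binz1 m : binz K m 1 = m%:~R.
Proof. by rewrite /binz big_ord_recl big_ord0 /= subr0 mulr1 divr1. Qed.

(* The Borcherds identity when only the first two terms of both series survive. *)
Lemma borcherds2 p q a b c m n k : par p a -> par q b ->
    (forall j : nat, (1 < j)%N -> binz K m j = 0 \/ a ∘_(n + j%:Z) b = 0) ->
    (forall j : nat, (1 < j)%N -> binz K n j = 0 \/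
       b ∘_(k + j%:Z) c = 0 /\ a ∘_(m + j%:Z) c = 0) ->
  (a ∘_(n) b) ∘_(m + k) c + m%:~R *: ((a ∘_(n + 1) b) ∘_(m + k - 1) c)
  = (a ∘_(m + n) (b ∘_(k) c)
      - ((-1) ^ n * (-1) ^+ (p && q)) *: (b ∘_(n + k) (a ∘_(m) c)))
    - n%:~R *: (a ∘_(m + n - 1) (b ∘_(k + 1) c)
      - ((-1) ^ n * (-1) ^+ (p && q)) *: (b ∘_(n + k - 1) (a ∘_(m + 1) c))).
Proof.
move=> pa qb hl hr.
have [N hN] := borcherds c m n k pa qb.
have := hN N.+2 (leq_trans (leqnSn _) (leqnSn _)).
rewrite !big_ord_recl /= [X in _ + (_ + X) = _ -> _]big1; last first.
  move=> j _; have [->|->] := hl (bump 0 (bump 0 j)) isT.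
    by rewrite scale0r.
  by rewrite nprod0l scaler0.
rewrite [X in _ = _ + (_ + X) -> _]big1; last first.
  move=> j _; have [->|[-> ->]] := hr (bump 0 (bump 0 j)) isT.
    by rewrite mulr0 scale0r.
  by rewrite !nprod0r scaler0 subr0 scaler0.
rewrite !addr0 /bump /= !binz0 expr1 expr0 mulr1 !scale1r !binz1.
by rewrite mulN1r scaleNr.
Qed.

Lemma binz0_gt1 j : (1 < j)%N -> binz K 0 j = 0.
Proof. by case: j => // j _; rewrite binz00. Qed.

(** The commutator formula, which is the Borcherds identity at [n = 0]; a simple pole leaves a
    single term. *)
Lemma nprod_comm p q a b c m k : par p a -> par q b -> pole 1 a b ->
  a ∘_(m) (b ∘_(k) c)
  = (a ∘_(0) b) ∘_(m + k) c + (-1) ^+ (p && q) *: (b ∘_(k) (a ∘_(m) c)).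
Proof.
move=> pa qb ab; have := @borcherds2 p q a b c m 0 k pa qb.
rewrite (ab (0 + 1)) // nprod0l scaler0 addr0 scale0r subr0 addr0 add0r.
rewrite expr0z mul1r => -> //; first by rewrite subrK.
  by move=> j hj; right; apply: ab; lia.
by move=> j hj; left; apply: binz0_gt1.
Qed.

Lemma nprod_comm0 p q a b c m k : par p a -> par q b -> pole 0 a b ->
  a ∘_(m) (b ∘_(k) c) = (-1) ^+ (p && q) *: (b ∘_(k) (a ∘_(m) c)).
Proof.
move=> pa qb ab; rewrite (nprod_comm _ _ _ pa qb) ?ab ?nprod0l ?add0r //.
exact: pole_le ab.
Qed.

(** The Borcherds identity at [m = n = 0], where both series stop after the first term, whatever the
    poles. *)
Lemma zero_mode_der p q a b c k : par p a -> par q b ->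
  a ∘_(0) (b ∘_(k) c)
  = (a ∘_(0) b) ∘_(k) c + (-1) ^+ (p && q) *: (b ∘_(k) (a ∘_(0) c)).
Proof.
move=> pa qb; have := @borcherds2 p q a b c 0 0 k pa qb.
rewrite !scale0r subr0 !add0r addr0 expr0z mul1r => -> //.
- by rewrite subrK.
- by move=> j hj; left; apply: binz0_gt1.
- by move=> j hj; left; apply: binz0_gt1.
Qed.

Lemma nprod_zero_mode p q a b c n : par p a -> par q b -> pole 1 a c -> pole 1 b c ->
  (a ∘_(n) b) ∘_(0) c = a ∘_(n) (b ∘_(0) c)
    - ((-1) ^ n * (-1) ^+ (p && q)) *: (b ∘_(n) (a ∘_(0) c)).
Proof.
move=> pa qb ac bc; have := @borcherds2 p q a b c 0 n 0 pa qb.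
rewrite scale0r !add0r !addr0 (ac 1) // (bc 1) // !nprod0r !scaler0 subr0 scaler0 subr0.
apply; first by move=> j hj; left; apply: binz0_gt1.
by move=> j hj; right; rewrite ac ?bc //; lia.
Qed.

(** Quasi-associativity, the Borcherds identity at [m = 0] and [n = k = -1]. The terms with index
    [-2] come from the simple poles with [c]; they are the quantum corrections to associativity. *)
Lemma wick_wick p q a b c : par p a -> par q b -> pole 1 a c -> pole 1 b c ->
  (a ∙ b) ∙ c = a ∙ b ∙ c + a ∘_(-2) (b ∘_(0) c)
    + (-1) ^+ (p && q) *: (b ∘_(-2) (a ∘_(0) c)).
Proof.
move=> pa qb ac bc; have := @borcherds2 p q a b c 0 (-1) (-1) pa qb.
rewrite scale0r !add0r !addr0 (ac 1) // nprod0r scaler0 subr0.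
rewrite exprN1 invrN1 mulN1r scaleN1r opprK scaleNr opprK => ->.
- by rewrite addrAC.
- by move=> j hj; left; apply: binz0_gt1.
- by move=> j hj; right; rewrite ac ?bc //; lia.
Qed.

Lemma wickA a b c p q : par p a -> par q b -> pole 0 a c -> pole 0 b c ->
  (a ∙ b) ∙ c = a ∙ b ∙ c.
Proof.
move=> pa qb ac bc; rewrite (wick_wick pa qb (pole_le (leqnSn _) ac) (pole_le (leqnSn _) bc)).
by rewrite (bc 0) // (ac 0) // !nprod0r scaler0 !addr0.
Qed.

Lemma wick_zero_mode p q a b c : par p a -> par q b -> pole 1 a c -> pole 1 b c ->
  (a ∙ b) ∘_(0) c = a ∙ (b ∘_(0) c) + (-1) ^+ (p && q) *: (b ∙ (a ∘_(0) c)).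
Proof.
by move=> pa qb ac bc; rewrite (nprod_zero_mode _ pa qb) // exprN1 invrN1 mulN1r scaleNr opprK.
Qed.

Lemma pole0_nprodr p q a b c k : par p a -> par q b -> pole 0 a b -> pole 0 a c ->
  pole 0 a (b ∘_(k) c).
Proof.
by move=> pa qb ab ac m hm; rewrite (nprod_comm0 _ _ _ pa qb) // ac // nprod0r scaler0.
Qed.

Lemma pole0_nprodl p q a b c n : par p a -> par q b -> pole 0 a c -> pole 0 b c ->
  pole 0 (a ∘_(n) b) c.
Proof.
move=> pa qb ac bc k hk; have := @borcherds2 p q a b c 0 n k pa qb.
rewrite scale0r !add0r !addr0 (bc k) // (ac 0) // (bc (k + 1)) ?(ac 1) //; last by lia.
rewrite !nprod0r !scaler0 subr0 scaler0 subr0.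
apply; first by move=> j hj; left; apply: binz0_gt1.
by move=> j hj; right; rewrite ac ?bc //; lia.
Qed.

(** Skew-symmetry, read off from the Borcherds identity on the vacuum at [m = n = -1] and
    [k = 0]. *)
Lemma wickC p q a b : par p a -> par q b -> pole 1 a b ->
  a ∙ b = transl (a ∘_(0) b) + (-1) ^+ (p && q) *: (b ∙ a).
Proof.
move=> pa qb ab; have := @borcherds2 p q a b vac (-1) (-1) 0 pa qb.
have v0 x (j : nat) : x ∘_(j%:Z) vac = 0 by apply: nprod_vac0.
rewrite !(v0 _ 0%N) !nprod0r !sub0r addr0 !nprod_vac exprN1 invrN1 mulN1r scaleN1r.
rewrite add0r (v0 _ 1%N) nprod0r scaler0 subr0 scaler0 subr0 scaleNr opprK addNr.
rewrite -opprD => e; apply/eqP; rewrite addrC -subr_eq; apply/eqP; apply: e.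
  by move=> j hj; right; apply: ab; lia.
move=> j hj; right; rewrite add0r v0; split=> //.
by rewrite (_ : -1 + j%:Z = j.-1%:Z) ?v0 //; lia.
Qed.

Lemma transl_wick a b p : par p a -> pole 0 a b -> transl a ∙ b = a ∘_(-2) b.
Proof.
move=> pa ab; have := @borcherds2 p false a vac b 0 (-2) (-1) pa (@par_vac _ V).
rewrite scale0r !add0r !addr0 !vac_nprod !eqxx (ab 0) // andbF mulr1.
rewrite (ab 1) // !scaler0 !subr0 (_ : -1 + 1 == -1 = false) // nprod0r scaler0.
rewrite subr0; apply; first by move=> j hj; left; apply: binz0_gt1.
move=> j hj; right; rewrite ab ?vac_nprod ?ifF //; lia.
Qed.

Lemma pole0_vacl a : pole 0 (vac : V) a.
Proof. by move=> n hn; rewrite vac_nprod ifF //; lia. Qed.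

Lemma pole0_vacr a : pole 0 a (vac : V).
Proof. by move=> [n|//] _; apply: nprod_vac0. Qed.

Lemma zero_mode_comm0 p q a b x : par p a -> par q b -> a ∘_(0) b = 0 ->
  a ∘_(0) (b ∘_(0) x) = (-1) ^+ (p && q) *: (b ∘_(0) (a ∘_(0) x)).
Proof. by move=> pa qb ab; rewrite (zero_mode_der _ _ pa qb) ab nprod0l add0r. Qed.

End VertexAlgebra.

(** * Jacobians of a coordinate change *)

Section ChangeOfCoordinates.
Variables (R : realType) (n : nat) (W V : set 'rV[R]_n).
Variables (g f : 'rV[R]_n -> 'rV[R]_n).
Hypotheses (oW : open W) (gW : forall x, W x -> V (g x)).
Hypotheses (smg : forall i, rsmooth W (comp_ g i)) (smf : forall i, rsmooth V (comp_ f i)).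
Hypothesis fK : forall x, W x -> f (g x) = x.
Local Notation E := 'rV[R]_n.
Implicit Types (i j k l m r s : 'I_n).

(** In both [jac] and [ijac] the first index belongs to a new coordinate and the second to an old
    one, so the inverse matrix is stored transposed. *)
Definition jac i s : E -> R := partial s (comp_ g i).
Definition ijac i j : E -> R := partial i (comp_ f j) \o g.
Definition ihess i l k : E -> R := partial i (partial l (comp_ f k)) \o g.

Lemma smooth_jac i s : rsmooth W (jac i s).
Proof. exact: rsmooth_partial. Qed.

Lemma smooth_ijac i j : rsmooth W (ijac i j).
Proof. by apply: rsmooth_comp gW _ smg => //; apply: rsmooth_partial. Qed.

Lemma smooth_ihess i l k : rsmooth W (ihess i l k).
Proof. by apply: rsmooth_comp gW _ smg => //; do 2?apply: rsmooth_partial. Qed.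

Lemma partial_chain_g (h : E -> R) r x : rsmooth V h -> W x ->
  partial r (h \o g) x = \sum_l partial l h (g x) * jac l r x.
Proof.
move=> hh Wx; rewrite partial_chain // => [l|]; first exact: rsmooth_diff (smg l) Wx.
exact: rsmooth_diff hh (gW Wx).
Qed.

Lemma ijac_jac j s x : W x -> \sum_i ijac i j x * jac i s x = (j == s)%:R.
Proof.
move=> Wx; rewrite -(partial_chain_g s (smf j) Wx).
rewrite (@partial_eq _ _ W (comp_ f j \o g) (@Defs.coord R n j)) //; last exact: mem_set.
  rewrite /partial deriveE; last exact: differentiable_coord.
  (* Bundled as a linear map, the coordinate is its own differential. *)
  have @cf : {linear E -> R}.
    by exists (fun N : E => N 0 j); do 2![eexists]; do ?[constructor];
     rewrite ?mxE// => ? *; rewrite ?mxE//; move=> ?; rewrite !mxE.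
  have -> : @Defs.coord R n j = cf by [].
  rewrite diff_lin /=; last exact: coord_continuous.
  by rewrite mxE eqxx eq_sym.
by move=> y /set_mem Wy; rewrite /Defs.coord /comp_ /= fK.
Qed.

(** Only [f (g x) = x] is assumed, but a left inverse of a square matrix is also a right inverse. *)
Lemma jac_ijac i k x : W x -> \sum_s jac i s x * ijac k s x = (i == k)%:R.
Proof.
move=> Wx.
pose F := \matrix_(j, i) ijac i j x; pose G := \matrix_(i, s) jac i s x.
have FG : F *m G = 1%:M.
  by apply/matrixP => a b; rewrite !mxE -(ijac_jac _ _ Wx); apply: eq_bigr => c _; rewrite !mxE.
have := mulmx1C FG => /matrixP/(_ i k); rewrite !mxE => <-.
by apply: eq_bigr => s _; rewrite !mxE.
Qed.

Lemma partial_ijac r i k x : W x ->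
  partial r (ijac i k) x = \sum_l ihess l i k x * jac l r x.
Proof. by move=> Wx; apply: partial_chain_g => //; apply: rsmooth_partial. Qed.

(* [dF = - F dG F] for [F] the inverse matrix of [G]. *)
Lemma partial_ijacE r l k x : W x ->
  partial r (ijac l k) x
  = - \sum_m \sum_s ijac m k x * partial r (jac m s) x * ijac l s x.
Proof.
move=> Wx.
have dj m s : differentiable (jac m s) x by apply: rsmooth_diff Wx; apply: smooth_jac.
have dF m s : differentiable (ijac m s) x by apply: rsmooth_diff Wx; apply: smooth_ijac.
have e m : \sum_s jac m s x * partial r (ijac l s) x
    = - \sum_s partial r (jac m s) x * ijac l s x.
  apply/eqP; rewrite -addr_eq0 -big_split /=; apply/eqP.
  have d0 : partial r (fun y => \sum_s jac m s y * ijac l s y) x = 0.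
    rewrite -[RHS](partial_cst ((m == l)%:R : R) r x).
    apply: (partial_eq _ oW); last exact: mem_set.
    by move=> y /set_mem Wy; rewrite jac_ijac.
  rewrite -[RHS]d0 partial_sum => [|s]; last exact: differentiableM.
  by apply: eq_bigr => s _; rewrite partialM // addrC.
transitivity (\sum_m ijac m k x * \sum_s jac m s x * partial r (ijac l s) x).
  under eq_bigr do rewrite mulr_sumr; rewrite exchange_big /=.
  rewrite (bigD1 k) //= [X in _ + X]big1 ?addr0 => [|s sk].
    under eq_bigr do rewrite mulrA; rewrite -mulr_suml ijac_jac // eqxx mul1r //.
  under eq_bigr do rewrite mulrA.
  by rewrite -mulr_suml ijac_jac // eq_sym (negbTE sk) mul0r.
rewrite -sumrN; apply: eq_bigr => m _; rewrite e mulrN mulr_sumr.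
by congr (- _); apply: eq_bigr => s _; rewrite mulrA.
Qed.

(** The chain rule [partial_ijac] is solved for the Hessian by contraction with the inverse
    Jacobian. What remains are derivatives of functions on [W], where the fields [beta] act. *)
Lemma ihessE i l k x : W x ->
  ihess i l k x = - \sum_r \sum_m \sum_s
    (ijac i r x * ijac m k x * ijac l s x) * partial r (jac m s) x.
Proof.
move=> Wx.
transitivity (\sum_r ijac i r x * partial r (ijac l k) x).
  have e m : \sum_r ijac i r x * (ihess m l k x * jac m r x)
      = ihess m l k x * (m == i)%:R.
    rewrite -(jac_ijac _ _ Wx) mulr_sumr; apply: eq_bigr => r _.
    by rewrite mulrCA [X in _ * X]mulrC.
  rewrite -(sum_delta (fun m => ihess m l k x) i).
  under [RHS]eq_bigr do rewrite partial_ijac // mulr_sumr.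
  by rewrite exchange_big; apply: eq_bigr => m _; rewrite -e.
rewrite -sumrN; apply: eq_bigr => r _; rewrite partial_ijacE // mulrN mulr_sumr.
congr (- _); apply: eq_bigr => m _; rewrite mulr_sumr; apply: eq_bigr => s _.
ring.
Qed.

(* The 1-form [tr (dF G)] is closed. *)
Lemma partial_jac_ijac_sym k m x : W x ->
  \sum_i \sum_j partial k (ijac i j) x * partial m (jac i j) x
  = \sum_i \sum_j partial k (jac i j) x * partial m (ijac i j) x.
Proof.
move=> Wx.
have [T TE] : {T : 'I_n -> 'I_n -> 'I_n -> 'I_n -> R | forall a b c d, T a b c d
    = ijac a d x * partial k (jac a b) x * ijac c b x * partial m (jac c d) x}.
  by eexists.
transitivity (- \sum_i \sum_j \sum_a \sum_b T a b i j).
  rewrite -sumrN; apply: eq_bigr => i _; rewrite -sumrN; apply: eq_bigr => j _.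
  rewrite partial_ijacE // mulNr mulr_suml; congr (- _); apply: eq_bigr => a _.
  by rewrite mulr_suml; apply: eq_bigr => b _; rewrite TE.
(* Exchanging the pairs [(a, b)] and [(i, j)] is the cyclicity of the trace of [F dG F dG]. *)
rewrite exchange_big4 -sumrN; apply: eq_bigr => a _; rewrite -sumrN; apply: eq_bigr => b _.
rewrite partial_ijacE // mulrN mulr_sumr; congr (- _); apply: eq_bigr => i _.
rewrite mulr_sumr; apply: eq_bigr => j _; rewrite TE.
move: (ijac a j x) (ijac i b x) (partial k (jac a b) x) (partial m (jac i j) x).
by move=> p q u v; ring.
Qed.

End ChangeOfCoordinates.

(** * The chiral de Rham complex in a chart *)

Section ChiralModel.
Variables (R : realType) (n : nat) (W : set 'rV[R]_n).
Local Notation E := 'rV[R]_n.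
Local Notation C := (R[i]).
Variables (V : vertexSuperalgebra C) (rho : chgen W -> V).
Hypothesis oW : open W.
Hypothesis hrho : chiral_model rho.
Implicit Types (f g : E -> C) (i j : 'I_n).

Fact fld_key : unit. Proof. exact: tt. Qed.
(* Locked, because comparing two images of functions by conversion would unfold
   the derivatives in them. *)
Definition fld f : V := locked_with fld_key (fn rho) f.
Lemma fldE f : fld f = fn rho f.
Proof. by rewrite /fld unlock. Qed.

Local Notation fn := fld.
Local Notation beta i := (rho (GBeta W i)).
Local Notation bb i := (rho (GB W i)).
Local Notation cc i := (rho (GC W i)).

Definition chQ : V := \sum_i beta i ∙ cc i.
Definition chD (x : V) : V := chQ ∘_(0) x.

(** An odd operator that anticommutes with itself is seen in this way to square to zero, as 2 is
    invertible. *)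
Lemma lmod_double_eq0 (x : V) : x = - x -> x = 0.
Proof.
move=> e; have : (2 : C) *: x = 0 by rewrite scaler_nat mulr2n {1}e addNr.
by move/(congr1 (fun y => 2^-1 *: y)); rewrite scalerA mulVf ?pnatr_eq0 // scale1r scaler0.
Qed.

Lemma fnE f (h : csmooth W f) : fn f = rho (GFun (exist _ f h)).
Proof.
rewrite fldE /Defs.fn; case: pselect => // h'.
by rewrite (Prop_irrelevance h h').
Qed.

Lemma fn_junk f : ~ csmooth W f -> fn f = 0.
Proof. by move=> h; rewrite fldE /Defs.fn; case: pselect. Qed.

Lemma fn_eq f g : csmooth W f -> {in W, f =1 g} -> fn f = fn g.
Proof.
move=> hf fg; rewrite !fldE; apply: (ch_eq hrho) => //; first exact: csmooth_eq hf.
by move=> x Wx; apply: fg; apply: mem_set.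
Qed.

Lemma fn1 : fn (fun=> 1) = vac.
Proof. by rewrite fldE (ch_one hrho). Qed.

Lemma fnM f g : csmooth W f -> csmooth W g -> fn f ∙ fn g = fn (fun x => f x * g x).
Proof. by rewrite !fldE; apply: (ch_mul hrho). Qed.

Lemma fn_lin (l : C) f g : csmooth W f -> csmooth W g ->
  fn (fun x => l * f x + g x) = l *: fn f + fn g.
Proof. by rewrite !fldE; apply: (ch_lin hrho). Qed.

Lemma fnD f g : csmooth W f -> csmooth W g -> fn (fun x => f x + g x) = fn f + fn g.
Proof.
move=> hf hg; rewrite -[fn f]scale1r -fn_lin //; congr fn.
by apply/funext => x; rewrite mul1r.
Qed.

Lemma fn_transl f : csmooth W f ->
  transl (fn f) = \sum_i fn (cpartial i f) ∙ transl (fn (cplx (@Defs.coord R n i))).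
Proof.
by move=> hf; rewrite fldE (ch_transl hrho) //; apply: eq_bigr => i _; rewrite !fldE.
Qed.

Lemma fn0 : fn (fun=> 0) = 0.
Proof.
have h := csmooth_cst W (0 : C).
by apply: (addrI (fn (fun=> 0))); rewrite addr0 -fnD //; under eq_fun do rewrite addr0.
Qed.

Lemma fnZ (l : C) f : csmooth W f -> fn (fun x => l * f x) = l *: fn f.
Proof.
move=> hf; rewrite -[RHS]addr0 -fn0 -fn_lin //; last exact: csmooth_cst.
by under [in RHS]eq_fun do rewrite addr0.
Qed.

Lemma fn_sum (I : Type) (r : seq I) (P : pred I) (F : I -> E -> C) :
  (forall k, csmooth W (F k)) ->
  fn (fun x => \sum_(k <- r | P k) F k x) = \sum_(k <- r | P k) fn (F k).
Proof.
move=> hF; elim: r => [|k r IH].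
  by rewrite big_nil -fn0; under eq_fun do rewrite big_nil.
rewrite big_cons -IH; under eq_fun do rewrite big_cons.
by case: (P k) => //; rewrite fnD //; apply: csmooth_sum.
Qed.

Lemma par_fn f : par false (fn f).
Proof.
have [h|h] := pselect (csmooth W f); last by rewrite fn_junk //; apply: par_zero.
by rewrite fnE; apply: (ch_par hrho (GFun _)).
Qed.
Lemma par_beta i : par false (beta i).
Proof. exact: (ch_par hrho (GBeta W i)). Qed.
Lemma par_b i : par true (bb i).
Proof. exact: (ch_par hrho (GB W i)). Qed.
Lemma par_c i : par true (cc i).
Proof. exact: (ch_par hrho (GC W i)). Qed.

Lemma pole1_gen (u v : chgen W) : pole 1 (rho u) (rho v).
Proof. by move=> [[|m]|//] // _; rewrite (ch_ope hrho). Qed.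

Lemma pole0_gen (u v : chgen W) : ope rho u v = 0 -> pole 0 (rho u) (rho v).
Proof. by move=> e [m|//] _; rewrite (ch_ope hrho) e if_same. Qed.

(** The junk value 0 has no poles, so the bounds below hold for every function. *)
Lemma pole_fnl N f (v : V) :
  (forall h : csmooth W f, pole N (rho (GFun (exist _ f h))) v) -> pole N (fn f) v.
Proof.
move=> h; have [hf|hf] := pselect (csmooth W f); first by rewrite fnE.
by rewrite fn_junk // => m _; rewrite nprod0l.
Qed.

Lemma pole_fnr N f (v : V) :
  (forall h : csmooth W f, pole N v (rho (GFun (exist _ f h)))) -> pole N v (fn f).
Proof.
move=> h; have [hf|hf] := pselect (csmooth W f); first by rewrite fnE.
by rewrite fn_junk // => m _; rewrite nprod0r.
Qed.

Lemma pole0_fn_fn f g : pole 0 (fn f) (fn g).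
Proof. by apply: pole_fnl => hf; apply: pole_fnr => hg; apply: pole0_gen. Qed.
Lemma pole0_fn_b f i : pole 0 (fn f) (bb i).
Proof. by apply: pole_fnl => hf; apply: pole0_gen. Qed.
Lemma pole0_fn_c f i : pole 0 (fn f) (cc i).
Proof. by apply: pole_fnl => hf; apply: pole0_gen. Qed.
Lemma pole0_b_fn f i : pole 0 (bb i) (fn f).
Proof. by apply: pole_fnr => hf; apply: pole0_gen. Qed.
Lemma pole0_c_fn f i : pole 0 (cc i) (fn f).
Proof. by apply: pole_fnr => hf; apply: pole0_gen. Qed.
Lemma pole0_c_c i j : pole 0 (cc i) (cc j).
Proof. exact: pole0_gen. Qed.
Lemma pole0_beta_b i j : pole 0 (beta i) (bb j).
Proof. exact: pole0_gen. Qed.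
Lemma pole0_beta_c i j : pole 0 (beta i) (cc j).
Proof. exact: pole0_gen. Qed.
Lemma pole0_c_beta i j : pole 0 (cc i) (beta j).
Proof. exact: pole0_gen. Qed.
Lemma pole0_beta_beta i j : pole 0 (beta i) (beta j).
Proof. exact: pole0_gen. Qed.
Lemma pole1_beta_fn f i : pole 1 (beta i) (fn f).
Proof. by apply: pole_fnr => hf; apply: pole1_gen. Qed.
Lemma pole1_fn_beta f i : pole 1 (fn f) (beta i).
Proof. by apply: pole_fnl => hf; apply: pole1_gen. Qed.

Lemma beta_fn i f : csmooth W f -> beta i ∘_(0) fn f = fn (cpartial i f).
Proof. by move=> hf; rewrite {1}fnE (ch_ope hrho (GBeta W i)) fldE. Qed.

Lemma fn_beta i f : csmooth W f -> fn f ∘_(0) beta i = - fn (cpartial i f).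
Proof. by move=> hf; rewrite {1}fnE (ch_ope hrho _ (GBeta W i)) fldE. Qed.

Lemma b_c i j : bb i ∘_(0) cc j = if i == j then vac else 0.
Proof. by rewrite -fn1 fldE; exact: (ch_ope hrho (GB W i) (GC W j) 0). Qed.

Lemma c_b i j : cc i ∘_(0) bb j = if i == j then vac else 0.
Proof. by rewrite -fn1 fldE; exact: (ch_ope hrho (GC W i) (GB W j) 0). Qed.

Lemma fn_wickA f g v : csmooth W f -> csmooth W g -> pole 0 (fn f) v -> pole 0 (fn g) v ->
  fn f ∙ fn g ∙ v = fn (fun x => f x * g x) ∙ v.
Proof. by move=> hf hg fx gx; rewrite -fnM // (wickA (par_fn _) (par_fn _)). Qed.

(** * Words in the fields [c] *)

Definition cword (s : seq 'I_n) : V := foldr (fun i x => cc i ∙ x) vac s.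

Lemma cword_cons i (s : seq 'I_n) : cword (i :: s) = cc i ∙ cword s.
Proof. by []. Qed.

Lemma par_cword (s : seq 'I_n) : par (odd (size s)) (cword s).
Proof.
elim: s => [|i s IH]; first exact: par_vac.
rewrite cword_cons; exact: (par_nprod _ (par_c i) IH).
Qed.

Lemma pole0_fn_cword f (s : seq 'I_n) : pole 0 (fn f) (cword s).
Proof.
elim: s => [|i s IH]; first exact: pole0_vacr.
rewrite cword_cons; exact: (pole0_nprodr _ (par_fn f) (par_c i) (@pole0_fn_c f i) IH).
Qed.

Lemma pole0_c_cword i (s : seq 'I_n) : pole 0 (cc i) (cword s).
Proof.
elim: s => [|j s IH]; first exact: pole0_vacr.
rewrite cword_cons; exact: (pole0_nprodr _ (par_c i) (par_c j) (@pole0_c_c i j) IH).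
Qed.

Lemma pole0_cword_fn f (s : seq 'I_n) : pole 0 (cword s) (fn f).
Proof.
elim: s => [|j s IH]; first exact: pole0_vacl.
rewrite cword_cons; exact: (pole0_nprodl _ (par_c j) (par_cword s) (@pole0_c_fn f j) IH).
Qed.

Lemma pole0_cword_cword (s t : seq 'I_n) : pole 0 (cword s) (cword t).
Proof.
elim: s => [|j s IH]; first exact: pole0_vacl.
rewrite cword_cons; exact: (pole0_nprodl _ (par_c j) (par_cword s) (@pole0_c_cword j t) IH).
Qed.

Lemma cword_cat (s t : seq 'I_n) : cword (s ++ t) = cword s ∙ cword t.
Proof.
elim: s => [|i s IH]; first by rewrite cat0s -[cword [::]]/(vac) vac_nprod.
rewrite cat_cons !cword_cons IH (wickA (par_c i) (par_cword s)) //; first exact: pole0_c_cword.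
exact: pole0_cword_cword.
Qed.

(** Functions and the fields [c] have regular OPEs with each other, so that the Wick product on them
    is associative and supercommutative. *)
Lemma form_mul f g (s t : seq 'I_n) : csmooth W f -> csmooth W g ->
  (fn f ∙ cword s) ∙ fn g ∙ cword t = fn (fun x => f x * g x) ∙ cword (s ++ t).
Proof.
move=> hf hg.
have p1 h u : pole 0 (fn h) (fn g ∙ cword u).
  by apply: (pole0_nprodr _ (par_fn _) (par_fn _));
    [apply: pole0_fn_fn | apply: pole0_fn_cword].
rewrite (wickA (par_fn f) (par_cword s)) //; last first.
  by apply: (pole0_nprodr _ (par_cword _) (par_fn _));
    [apply: pole0_cword_fn | apply: pole0_cword_cword].
rewrite (nprod_comm0 _ _ _ (par_cword s) (par_fn g)); last exact: pole0_cword_fn.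
rewrite andbF scale1r -cword_cat fn_wickA //; exact: pole0_fn_cword.
Qed.

Lemma cwordC i j (s : seq 'I_n) : cword [:: i, j & s] = - cword [:: j, i & s].
Proof.
by rewrite !cword_cons (nprod_comm0 _ _ _ (par_c i) (par_c j)) ?scaleN1r //; apply: pole0_c_c.
Qed.

Lemma cword_move i (s t : seq 'I_n) : cword (i :: s ++ t) = (-1) ^+ size s *: cword (s ++ i :: t).
Proof.
elim: s => [|j s IH]; first by rewrite scale1r.
rewrite cat_cons cwordC cword_cons IH nprodZr exprS -scalerA scaleN1r //.
Qed.

(** Moved next to its second copy, the letter [i] anticommutes with itself. *)
Lemma cword_dup i (s : seq 'I_n) : i \in s -> cword (i :: s) = 0.
Proof.
case/splitPr => s1 s2; rewrite cword_move cword_cat.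
rewrite [cword [:: i, i & s2]](_ : _ = 0) ?nprod0r ?scaler0 //.
by apply: lmod_double_eq0; apply: cwordC.
Qed.

Lemma cword_enum i (I : {set 'I_n}) :
  cword (i :: enum I)
  = if i \in I then 0 else (-1) ^+ #|below i I| *: cword (enum (i |: I)).
Proof.
case: ifPn => [iI|iI]; first by rewrite cword_dup // mem_enum.
rewrite {1}(enum_split iI) cword_move -enum_setU1; congr (_ ^+ _ *: _).
rewrite cardE; congr size; apply: sorted_enum; last first.
  by move=> j; rewrite mem_filter mem_enum !inE andbC.
apply: sorted_filter; first exact: (@olt_trans n).
by have := enum_sorted I; rewrite sorted_map.
Qed.

(** * The differential in a chart and its restriction to forms *)

Lemma chD0 : chD 0 = 0 :> V. Proof. exact: nprod0r. Qed.

Lemma chDD (x y : V) : chD (x + y) = chD x + chD y.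
Proof. exact: nprodDr. Qed.

Lemma chD_sum (I : Type) (r : seq I) (P : pred I) (F : I -> V) :
  chD (\sum_(k <- r | P k) F k) = \sum_(k <- r | P k) chD (F k).
Proof. exact: nprod_sumr. Qed.

Lemma par_chQ : par true chQ.
Proof.
by apply: par_sum => i _; apply: (par_nprod _ (par_beta i) (par_c i)).
Qed.

Lemma chD_der p (x y : V) k : par p x ->
  chD (x ∘_(k) y) = chD x ∘_(k) y + (-1) ^+ p *: (x ∘_(k) chD y).
Proof. exact: (zero_mode_der _ _ par_chQ). Qed.

Lemma chD_gen (v : V) : (forall i, pole 1 (beta i) v) ->
    (forall i, pole 1 (cc i) v) ->
  chD v = \sum_i (beta i ∙ (cc i ∘_(0) v) + cc i ∙ (beta i ∘_(0) v)).
Proof.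
move=> hb hc; rewrite /chD nprod_suml; apply: eq_bigr => i _.
by rewrite (wick_zero_mode (par_beta i) (par_c i)) // scale1r.
Qed.

Lemma chD_fn f : csmooth W f -> chD (fn f) = \sum_i fn (cpartial i f) ∙ cc i.
Proof.
move=> hf; rewrite chD_gen => [|i|i]; last 2 first.
- exact: pole1_beta_fn.
- exact: (pole_le (leqnSn _) (@pole0_c_fn f i)).
apply: eq_bigr => i _; rewrite (@pole0_c_fn f i 0) // nprod0r add0r beta_fn //.
rewrite (wickC (par_fn _) (par_c i)) ?scale1r; last exact: (pole_le (leqnSn _) (@pole0_fn_c _ i)).
by rewrite (@pole0_fn_c _ i 0) // /transl nprod0l add0r.
Qed.

Lemma chD_c i : chD (cc i) = 0.
Proof.
rewrite chD_gen => [|j|j]; [|exact: pole1_gen|exact: pole1_gen].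
rewrite big1 // => j _.
by rewrite (@pole0_c_c j i 0) // (@pole0_beta_c j i 0) // !nprod0r addr0.
Qed.

Lemma chD_b i : chD (bb i) = beta i.
Proof.
rewrite chD_gen => [|j|j]; [|exact: pole1_gen|exact: pole1_gen].
rewrite (bigD1 i) // big1 => [|j ji].
  by rewrite [LHS]addr0 c_b eqxx nprod_vac (@pole0_beta_b i i 0) // nprod0r addr0.
by rewrite c_b (negbTE ji) (@pole0_beta_b j i 0) // !nprod0r addr0.
Qed.

Lemma chD_beta i : chD (beta i) = 0.
Proof.
rewrite chD_gen => [|j|j]; [|exact: pole1_gen|exact: pole1_gen].
rewrite big1 // => j _.
by rewrite (@pole0_c_beta j i 0) // (@pole0_beta_beta j i 0) // !nprod0r addr0.
Qed.

Lemma chD_Q : chD chQ = 0.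
Proof.
rewrite /chQ chD_sum big1 // => i _.
by rewrite (chD_der _ _ (par_beta i)) chD_beta chD_c nprod0l nprod0r scaler0 addr0.
Qed.

Lemma chD_sq (x : V) : chD (chD x) = 0.
Proof.
apply: lmod_double_eq0.
by rewrite {1}/chD (zero_mode_comm0 _ par_chQ par_chQ chD_Q) scaleN1r.
Qed.

Lemma twisted_sq (h x : V) : par true h -> pole 0 h h -> chD h = 0 ->
  chD (chD x + h ∙ x) + h ∙ (chD x + h ∙ x) = 0.
Proof.
move=> ph hh Dh; rewrite chDD chD_sq add0r (chD_der _ _ ph) Dh nprod0l add0r nprodDr.
rewrite scaleN1r addKr; apply: lmod_double_eq0.
by rewrite {1}(nprod_comm0 _ _ _ ph ph hh) scaleN1r.
Qed.

Lemma chD_cword (s : seq 'I_n) : chD (cword s) = 0.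
Proof.
elim: s => [|i s IH]; first exact: nprod_vac0 0%N _.
by rewrite cword_cons (chD_der _ _ (par_c i)) chD_c IH nprod0l nprod0r scaler0 addr0.
Qed.

(** This is [iota_ch] in an arbitrary model, with the locked [fld] for the functions. *)
Definition chform (eta : localform R n) : V :=
  \sum_(I : {set 'I_n}) fn (eta I) ∙ cword (enum I).

Lemma par_chform (eta : localform R n) :
  (forall (I : {set 'I_n}) x, W x -> ~~ odd #|I| -> eta I x = 0) ->
  par true (chform eta).
Proof.
move=> he; rewrite /chform; apply: par_sum => I _.
have [oI|oI] := boolP (odd #|I|).
  have := par_nprod (-1) (par_fn (eta I)) (par_cword (enum I)).
  by rewrite -cardE oI.
rewrite (_ : fn (eta I) = 0) ?nprod0l; first exact: par_zero.
have [h|h] := pselect (csmooth W (eta I)); last exact: fn_junk.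
by rewrite -fn0; apply: fn_eq => // x /set_mem Wx; apply: he.
Qed.

Lemma pole0_form f g (s t : seq 'I_n) : pole 0 (fn f ∙ cword s) (fn g ∙ cword t).
Proof.
apply: (pole0_nprodl _ (par_fn f) (par_cword s)).
  apply: (pole0_nprodr _ (par_fn f) (par_fn g)); first exact: pole0_fn_fn.
  exact: pole0_fn_cword.
apply: (pole0_nprodr _ (par_cword s) (par_fn g)); first exact: pole0_cword_fn.
exact: pole0_cword_cword.
Qed.

Lemma pole0_chform (eta theta : localform R n) : pole 0 (chform eta) (chform theta).
Proof.
move=> m hm; rewrite /chform nprod_suml big1 // => I _.
by rewrite nprod_sumr big1 // => J _; apply: pole0_form.
Qed.

Lemma chD_chform (eta : localform R n) : (forall I, csmooth W (eta I)) ->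
  chD (chform eta) = chform (dform eta).
Proof.
move=> he; rewrite /chform chD_sum.
(* The argument [K] stands for [i |: I]; it is kept apart so that [sum_setU1] can change the
   summation index. *)
pose T i (I K : {set 'I_n}) : V :=
  (-1) ^+ #|below i I| *: (fn (cpartial i (eta I)) ∙ cword (enum K)).
transitivity (\sum_(I : {set 'I_n}) \sum_(i | i \notin I) T i I (i |: I)).
  apply: eq_bigr => I _; rewrite (chD_der _ _ (par_fn _)) chD_cword nprod0r scaler0 addr0.
  rewrite chD_fn // nprod_suml [RHS]big_mkcond; apply: eq_bigr => i _.
  rewrite (wickA (par_fn _) (par_c i)); [|exact: pole0_fn_cword|exact: pole0_c_cword].
  rewrite -cword_cons cword_enum; case: ifP => _; first by rewrite nprod0r.
  by rewrite nprodZr.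
transitivity (\sum_i \sum_(K : {set 'I_n} | i \in K) T i (K :\ i) K).
  rewrite (exchange_big_dep xpredT) //; apply: eq_bigr => i _; exact: sum_setU1.
rewrite (exchange_big_dep xpredT) //; apply: eq_bigr => K _.
rewrite [dform eta K](_ : _ = fun x => \sum_(i in K) (-1) ^+ #|[set j in K | (j < i)%N]|
   * cpartial i (eta (K :\ i)) x) // fn_sum; last first.
  by move=> i; apply: csmoothZ => //; apply: csmooth_cpartial.
rewrite nprod_suml; apply: eq_bigr => i iK.
rewrite fnZ; last exact: csmooth_cpartial.
rewrite nprodZl /T; congr (_ ^+ _ *: _); apply: eq_card => j; rewrite !inE.
by case: (ltnP j i) => //= [ji|]; rewrite ?andbF // (_ : j != i) //;
  case: eqP ji => // ->; rewrite ltnn.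
Qed.

Lemma cword_not_uniq (s : seq 'I_n) : ~~ uniq s -> cword s = 0.
Proof.
elim: s => [//|i s IH]; rewrite cons_uniq negb_and negbK => /orP[|/IH]; first exact: cword_dup.
by rewrite cword_cons => ->; rewrite nprod0r.
Qed.

(** By induction on the enumeration of [I]. Its head [i] is the least element, so on its way into
    the sorted word it passes only elements of [J], which adds one summand to [inversions]. *)
Lemma cword_enum_cat (I J : {set 'I_n}) :
  cword (enum I ++ enum J) = if [disjoint I & J]
    then (-1) ^+ inversions I J *: cword (enum (I :|: J)) else 0.
Proof.
case: ifPn => dIJ; last first.
  apply: cword_not_uniq; rewrite cat_uniq !enum_uniq andbT /=; apply: contra dIJ => h.
  rewrite disjoint_sym; apply/pred0P => j /=; apply: contraNF h => /andP[jJ jI].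
  by apply/hasP; exists j; rewrite mem_enum.
move es : (enum I) => s; elim: s => [|i s IH] in I es dIJ *.
  have -> : I = finset.set0 by apply/setP => j; rewrite -mem_enum es !inE.
  by rewrite /inversions big_set0 finset.set0U scale1r.
have := enum_sorted I; rewrite es sorted_map => so.
have us : uniq (i :: s) by rewrite -es enum_uniq.
pose I' := [set j in s].
have eI : I = i |: I' by apply/setP => j; rewrite -mem_enum es !inE.
have es' : enum I' = s.
  apply/esym/sorted_enum; first exact: path_sorted so.
  by move=> j; rewrite inE.
have iI' : i \notin I' by rewrite inE; case/andP: us.
have /andP[iJ dI'J] : (i \notin J) && [disjoint I' & J]%B.
  move: dIJ; rewrite eI finset.disjoints_subset finset.subUset finset.sub1set inE.
  by rewrite -finset.disjoints_subset.
rewrite cat_cons cword_cons (IH _ es' dI'J) nprodZr -cword_cons cword_enum.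
rewrite inE (negbTE iI') (negbTE iJ) /= scalerA -exprD finset.setUA -eI.
rewrite /inversions eI (big_setU1 _ iI') addnC; congr (_ ^+ (_ + _) *: _).
apply: eq_card => j; rewrite !inE; case: (boolP (j \in s)) => // js /=.
suff /ltnW : (i < j)%N by rewrite leqNgt => /negbTE ->; rewrite andbF.
by have /allP := order_path_min (@olt_trans n) so; apply.
Qed.

Lemma chform_wedge (eta theta : localform R n) :
  (forall I, csmooth W (eta I)) -> (forall I, csmooth W (theta I)) ->
  chform eta ∙ chform theta = chform (wedge eta theta).
Proof.
move=> he ht; rewrite /chform nprod_suml.
pose T (I J K : {set 'I_n}) : V := (-1) ^+ inversions I J *:
  (fn (fun x => eta I x * theta J x) ∙ cword (enum K)).
transitivity (\sum_(I : {set 'I_n}) \sum_(J : {set 'I_n} | [disjoint I & J]) T I J (I :|: J)).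
  apply: eq_bigr => I _; rewrite nprod_sumr [RHS]big_mkcond; apply: eq_bigr => J _.
  rewrite form_mul // cword_enum_cat; case: ifP => _; last by rewrite nprod0r.
  by rewrite nprodZr.
transitivity (\sum_(I : {set 'I_n}) \sum_(K : {set 'I_n} | I \subset K) T I (K :\: I) K).
  apply: eq_bigr => I _.
  rewrite (reindex_onto (fun K : {set 'I_n} => K :\: I)
    (fun J : {set 'I_n} => I :|: J)) /=; last first.
    move=> J dIJ; rewrite finset.setDUl finset.setDv finset.set0U; apply/finset.setDidPl.
    by rewrite disjoint_sym.
  apply: eq_big => [K|K /andP[_ /eqP->]] //.
  have -> : [disjoint I & K :\: I]%B.
    rewrite disjoint_sym -finset.setI_eq0 finset.setDE -finset.setIA.
    by rewrite [_ :&: I]finset.setIC finset.setICr finset.setI0.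
  rewrite finset.setDE finset.setUIr finset.setUCr finset.setIT.
  by apply/eqP/finset.setUidPr.
rewrite (exchange_big_dep xpredT) //; apply: eq_bigr => K _.
rewrite /wedge fn_sum; last first.
  by move=> I; do 2?apply: csmoothM => //; apply: csmooth_cst.
rewrite nprod_suml; apply: eq_bigr => I _.
under [in RHS]eq_fun do rewrite -mulrA.
rewrite fnZ; last exact: csmoothM.
by rewrite nprodZl card_inversions.
Qed.

(** * Words in the transformed fields [c] *)

Section NewWords.
Variable G : 'I_n -> 'I_n -> E -> R.
Hypothesis smooth_G : forall i j, rsmooth W (G i j).
Implicit Types (I J K : {set 'I_n}).
Local Notation ct i := (\sum_j fn (cplx (G i j)) ∙ cc j).
Local Notation gminor p t u := (cplx (fun x => minor (fun i j => G i j x) p t u)).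

Definition nword (t : seq 'I_n) : V := foldr (fun i x => ct i ∙ x) vac t.

Lemma csmooth_gminor p (t u : seq 'I_n) : csmooth W (gminor p t u).
Proof. by apply/csmooth_cplx/rsmooth_minor. Qed.

Lemma csmooth_G i j : csmooth W (cplx (G i j)).
Proof. exact: csmooth_cplx. Qed.

Hint Resolve csmooth_gminor csmooth_G : core.

(** The expansion of a product of 1-forms into minors; multiplication by one more factor on the left
    is the Laplace expansion along the first column. *)
Lemma nword_minor (u : seq 'I_n) : nword u
  = \sum_(I : {set 'I_n} | #|I| == size u) fn (gminor (size u) (enum I) u) ∙ cword (enum I).
Proof.
elim: u => [|j u IH].
  rewrite (big_pred1 finset.set0) => [|I]; last by rewrite cards_eq0.
  have -> : gminor 0 (enum (finset.set0 : {set 'I_n})) [::] = fun=> 1.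
    by apply/funext => x; rewrite /cplx /minor det_mx00.
  have -> : enum (finset.set0 : {set 'I_n}) = [::].
    by apply/nilP; rewrite /nilp -cardE cards0.
  by rewrite fn1 vac_nprod.
pose T i I K : V := (-1) ^+ #|below i I| *:
  (fn (fun x => cplx (G j i) x * gminor (size u) (enum I) u x) ∙ cword (enum K)).
pose F i I K := if #|I| == size u then T i I K else 0.
transitivity (\sum_i \sum_(I : {set 'I_n} | i \notin I) F i I (i |: I)).
  rewrite -[nword (j :: u)]/(ct j ∙ nword u) IH nprod_suml; apply: eq_bigr => i _.
  rewrite nprod_sumr big_mkcond [RHS]big_mkcond; apply: eq_bigr => I _.
  rewrite /F; case: eqP => _; last by rewrite if_same.
  rewrite -[cc i]nprod_vac -[vac]/(cword [::]) -cword_cons form_mul //.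
  by rewrite cat1s cword_enum if_neg; case: ifP => _; rewrite ?nprod0r // nprodZr.
transitivity (\sum_i \sum_(K : {set 'I_n} | i \in K) F i (K :\ i) K).
  by apply: eq_bigr => i _; exact: sum_setU1.
rewrite (exchange_big_dep xpredT) // [RHS]big_mkcond; apply: eq_bigr => K _.
have cK i : i \in K -> (#|K :\ i| == size u) = (#|K| == (size u).+1).
  by move=> iK; rewrite (cardsD1 i K) iK add1n eqSS.
case: ifP => eK; last first.
  by rewrite big1 // => i iK; rewrite /F cK // eK.
have sT i : csmooth W (fun x => cplx (G j i) x * gminor (size u) (enum (K :\ i)) u x).
  exact: csmoothM.
have -> : fn (gminor (size u).+1 (enum K) (j :: u)) = fn (fun x => \sum_(i in K)
    (-1) ^+ #|below i (K :\ i)| * (cplx (G j i) x * gminor (size u) (enum (K :\ i)) u x)).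
  apply: fn_eq => // x Wx; rewrite /cplx minor_cons; last exact/eqP.
  by rewrite rmorph_sum; apply: eq_bigr => i _; rewrite !rmorphM rmorph_sign.
rewrite fn_sum; last by move=> i; apply: csmoothZ.
rewrite nprod_suml; apply: eq_bigr => i iK.
by rewrite /F cK // eK /T fnZ // nprodZl.
Qed.

(** The relation between [theta] and [eta] is the pullback formula, where [eta] is already composed
    with the change of coordinates. *)
Lemma chform_new (eta theta : localform R n) :
  (forall J, csmooth W (eta J)) -> (forall I, csmooth W (theta I)) ->
  (forall I x, W x -> theta I x = \sum_(J : {set 'I_n} | #|J| == #|I|)
     eta J x * gminor #|I| (enum I) (enum J) x) ->
  \sum_(J : {set 'I_n}) fn (eta J) ∙ nword (enum J) = chform theta.
Proof.
move=> he ht e.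
transitivity (\sum_(J : {set 'I_n}) \sum_(I : {set 'I_n} | #|I| == #|J|)
   fn (fun x => eta J x * gminor #|I| (enum I) (enum J) x) ∙ cword (enum I)).
  apply: eq_bigr => J _; rewrite nword_minor -cardE nprod_sumr; apply: eq_bigr => I /eqP <-.
  by rewrite fn_wickA //; apply: pole0_fn_cword.
rewrite (exchange_big_dep xpredT) //; apply: eq_bigr => I _.
rewrite -nprod_suml -fn_sum; last by move=> J; apply: csmoothM.
congr (_ ∙ _); apply/esym/fn_eq => // x /set_mem Wx; rewrite e //.
by apply: eq_bigl => J; rewrite eq_sym.
Qed.

End NewWords.

Hypothesis generated : forall x : V, exists u, x = ev rho u.

(** A zero mode is a derivation of all products, so it vanishes once it vanishes on generators. The
    derivation rule has a sign that depends on parity, hence the passage to the homogeneous parts of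
    an expression. *)
Lemma zero_mode_eq0 p (a : V) : par p a ->
  (forall u, a ∘_(0) rho u = 0) -> forall x : V, a ∘_(0) x = 0.
Proof.
move=> pa ha x.
suff h (u : chterm W) q : a ∘_(0) ev rho (part q u) = 0.
  have [t ->] := generated x.
  by rewrite ev_part nprodDr !h addr0.
elim: u q => [u|||u IHu v IHv|k u IHu|m u IHu v IHv] q.
- by rewrite [part _ _]/=; case: eqP => _; [apply: ha | rewrite nprod0r].
- exact: nprod0r.
- by case: q; [exact: nprod0r | exact: nprod_vac0 0%N _].
- by rewrite -[ev _ _]/(ev _ (part q u) + ev _ (part q v)) nprodDr IHu IHv addr0.
- by rewrite -[ev _ _]/(k *: ev _ (part q u)) nprodZr IHu scaler0.
- rewrite -[ev _ _]/(ev _ (part false u) ∘_(m) ev _ (part q v)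
    + ev _ (part true u) ∘_(m) ev _ (part (~~ q) v)).
  rewrite nprodDr !(zero_mode_der _ _ pa (par_part hrho _ _)) !IHu !IHv.
  by rewrite !nprod0l !nprod0r !scaler0 !addr0.
Qed.

(* Below, [y] stands for the new coordinates, [jac] and [ijac] for the Jacobian
   matrix and its inverse, and [ihess] for the second derivatives of the old
   coordinates.  They are kept abstract lest conversion unfold the derivatives. *)
Section NewFields.
Implicit Types (k l m r s : 'I_n).
Variables (y : 'I_n -> E -> R) (jac ijac : 'I_n -> 'I_n -> E -> R).
Variable ihess : 'I_n -> 'I_n -> 'I_n -> E -> R.
Variables djac dijac : 'I_n -> 'I_n -> 'I_n -> E -> R.
Hypothesis smooth_y : forall i, rsmooth W (y i).
Hypothesis jacE : forall i s, jac i s = partial s (y i).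
Hypothesis smooth_jac : forall i s, rsmooth W (jac i s).
Hypothesis djacE : forall r i s, djac r i s = partial r (jac i s).
Hypothesis dijacE : forall r i j, dijac r i j = partial r (ijac i j).
Hypothesis smooth_ijac : forall i j, rsmooth W (ijac i j).
Hypothesis smooth_ihess : forall i l k, rsmooth W (ihess i l k).
Hypothesis ijac_jac : forall j s x, W x ->
  \sum_i ijac i j x * jac i s x = (j == s)%:R.
Hypothesis partial_ijac : forall r i k x, W x ->
  dijac r i k x = \sum_l ihess l i k x * jac l r x.
Hypothesis ihessE : forall i l k x, W x ->
  ihess i l k x = - \sum_r \sum_m \sum_s
    (ijac i r x * ijac m k x * ijac l s x) * djac r m s x.
Hypothesis partial_jac_ijac_sym : forall k m x, W x ->
  \sum_i \sum_j dijac k i j x * djac m i j x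
  = \sum_i \sum_j djac k i j x * dijac m i j x.

Local Notation Fc i j := (cplx (ijac i j)).
Local Notation Gc i j := (cplx (jac i j)).

Lemma csmooth_Fc i j : csmooth W (Fc i j).
Proof. exact/csmooth_cplx/smooth_ijac. Qed.

Lemma csmooth_Gc i j : csmooth W (Gc i j).
Proof. exact/csmooth_cplx/smooth_jac. Qed.

Hint Resolve csmooth_Fc csmooth_Gc : core.

Lemma cpartial_Fc r i j : cpartial r (Fc i j) = cplx (dijac r i j).
Proof. by rewrite dijacE cpartial_cplx. Qed.

Lemma cpartial_Gc r i j : cpartial r (Gc i j) = cplx (djac r i j).
Proof. by rewrite djacE cpartial_cplx. Qed.

Lemma csmooth_dFc r i j : csmooth W (cplx (dijac r i j)).
Proof. by rewrite -cpartial_Fc; apply: csmooth_cpartial. Qed.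

Lemma csmooth_dGc r i j : csmooth W (cplx (djac r i j)).
Proof. by rewrite -cpartial_Gc; apply: csmooth_cpartial. Qed.

Hint Resolve csmooth_dFc csmooth_dGc : core.

Lemma cplxM (a b : E -> R) : cplx (fun x => a x * b x) = fun x => cplx a x * cplx b x.
Proof. by apply/funext => x; rewrite /cplx rmorphM. Qed.

(* This holds without Schwarz's theorem, since the zero modes of the [beta]'s
   commute. *)
Lemma fn_cpartialC i j (h : E -> C) : csmooth W h ->
  fn (cpartial i (cpartial j h)) = fn (cpartial j (cpartial i h)).
Proof.
move=> sh; have e a b : fn (cpartial a (cpartial b h)) = beta a ∘_(0) (beta b ∘_(0) fn h).
  by rewrite beta_fn // beta_fn //; apply: csmooth_cpartial.
apply: etrans (e i j) (etrans _ (esym (e j i))).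
rewrite (zero_mode_comm0 _ (par_beta i) (par_beta j)) ?scale1r //.
exact: pole0_beta_beta.
Qed.

Lemma fn_partialC i j (h : E -> R) : rsmooth W h ->
  fn (cplx (partial i (partial j h))) = fn (cplx (partial j (partial i h))).
Proof.
move=> sh; have e a b : cpartial a (cpartial b (cplx h)) = cplx (partial a (partial b h)).
  exact: etrans (congr1 (cpartial a) (cpartial_cplx b h)) (cpartial_cplx a (partial b h)).
apply: etrans (congr1 fn (esym (e i j))) (etrans _ (congr1 fn (e j i))).
exact: fn_cpartialC (csmooth_cplx sh).
Qed.

(* The second derivatives of the inverse coordinate change are a combination of
   those of the coordinate change itself, which are symmetric by [fn_cpartialC]. *)
Lemma fn_ihessC i l k : fn (cplx (ihess i l k)) = fn (cplx (ihess l i k)).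
Proof.
have sD r m s : csmooth W (cplx (djac r m s)).
  by rewrite djacE; apply: csmooth_cplx; apply: rsmooth_partial; apply: smooth_jac.
pose T a b r m s := (fun x => Fc a r x * Fc m k x * Fc b s x).
have sT a b r m s : csmooth W (T a b r m s) by do 2?apply: csmoothM.
have e a b : fn (cplx (ihess a b k)) = - \sum_r \sum_m \sum_s
    fn (T a b r m s) ∙ fn (cplx (djac r m s)).
  have -> : fn (cplx (ihess a b k)) = fn (fun x => (-1) *
      \sum_r \sum_m \sum_s (T a b r m s x * cplx (djac r m s) x)).
    apply: fn_eq => //; first exact/csmooth_cplx/smooth_ihess.
    move=> x /set_mem Wx; rewrite /cplx ihessE // rmorphN mulN1r rmorph_sum.
    congr (- _); apply: eq_bigr => r _; rewrite rmorph_sum; apply: eq_bigr => m _.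
    by rewrite rmorph_sum; apply: eq_bigr => s _; rewrite !rmorphM.
  have sS r m s : csmooth W (fun x => T a b r m s x * cplx (djac r m s) x).
    exact: csmoothM.
  rewrite fnZ; last by do 3?[apply: csmooth_sum => // ?].
  rewrite scaleN1r; congr (- _).
  rewrite fn_sum //; last by move=> r; do 2?[apply: csmooth_sum => // ?].
  apply: eq_bigr => r _; rewrite fn_sum //; last by move=> m; apply: csmooth_sum.
  apply: eq_bigr => m _; rewrite fn_sum //.
  by apply: eq_bigr => s _; rewrite fnM.
rewrite !e; congr (- _).
transitivity (\sum_r \sum_s \sum_m
   fn (T i l r m s) ∙ fn (cplx (djac r m s))).
  by apply: eq_bigr => r _; rewrite exchange_big.
rewrite exchange_big; apply: eq_bigr => s _.
rewrite [RHS]exchange_big; apply: eq_bigr => r _; apply: eq_bigr => m _.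
(* Exchanging [i] and [l] amounts to exchanging [r] and [s], which leaves the second derivative of
   the [m]-th new coordinate unchanged. *)
have -> : T l i s m r = T i l r m s.
  by apply/funext => x; rewrite /T mulrAC [X in X * _]mulrC mulrAC [X in X * _]mulrC mulrAC.
congr (_ ∙ _); rewrite !djacE !jacE; exact: fn_partialC.
Qed.

(** The chain rule produces [ihess l i k], while the gluing formula for [beta] contains
    [ihess i l k]; the symmetry of the Hessian reconciles them. *)
Lemma fn_partial_ijac r i k : fn (cplx (dijac r i k))
  = \sum_l fn (cplx (fun x => ihess i l k x * jac l r x)).
Proof.
have sH a b : csmooth W (cplx (ihess a b k)) by apply/csmooth_cplx/smooth_ihess.
have sHG a b : csmooth W (fun x => cplx (ihess a b k) x * Gc a r x) by apply: csmoothM.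
transitivity (fn (fun x => \sum_l cplx (ihess l i k) x * Gc l r x)).
  apply: fn_eq => //.
  by move=> x /set_mem Wx; rewrite /cplx partial_ijac // rmorph_sum;
    apply: eq_bigr => l _; rewrite rmorphM.
rewrite fn_sum //; apply: eq_bigr => l _.
by rewrite cplxM -!fnM // fn_ihessC.
Qed.

Local Notation bt i := (\sum_j fn (Fc i j) ∙ bb j).
Local Notation ct i := (\sum_j fn (Gc i j) ∙ cc j).
Local Notation betat i := (\sum_j beta j ∙ fn (Fc i j)
      + \sum_k \sum_l \sum_r
          fn (cplx (fun x => ihess i l k x * jac l r x)) ∙ cc r ∙ bb k).

(** The new field [c] is exact, being the differential of the new coordinate. *)
Lemma chD_new_c i : chD (ct i) = 0.
Proof.
have -> : ct i = chD (fn (cplx (y i))).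
  rewrite chD_fn; last exact: csmooth_cplx.
  by apply: eq_bigr => j _; rewrite cpartial_cplx jacE.
exact: chD_sq.
Qed.

(* The derivative corrections to the two Wick products cancel. *)
Lemma chD_new_b i : chD (bt i) = betat i.
Proof.
transitivity (\sum_j (beta j ∙ fn (Fc i j)
    + \sum_r fn (cplx (dijac r i j)) ∙ cc r ∙ bb j)).
  rewrite chD_sum; apply: eq_bigr => j _.
  rewrite (chD_der _ _ (par_fn _)) chD_b scale1r chD_fn // nprod_suml.
  rewrite [in RHS](wickC (par_beta j) (par_fn _)); last exact: pole1_beta_fn.
  rewrite scale1r beta_fn // cpartial_Fc [RHS]addrC addrA; congr (_ + _).
  (* The contraction of [c^r] with [b^j] leaves a derivative only for [r = j], and this is the one
     produced by moving [beta^j] past [F]. *)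
  transitivity (\sum_r (fn (cplx (dijac r i j)) ∙ cc r ∙ bb j
      + if r == j then transl (fn (cplx (dijac r i j))) else 0)).
    apply: eq_bigr => r _; rewrite cpartial_Fc.
    rewrite (wick_wick (par_fn _) (par_c r)); last 2 first.
    - exact: pole_le (leqnSn _) (@pole0_fn_b _ j).
    - exact: pole1_gen.
    rewrite (@pole0_fn_b _ j 0) // nprod0r scaler0 addr0 c_b; congr (_ + _).
    by case: eqP => // _; rewrite nprod0r.
  by rewrite big_split -big_mkcond big_pred1_eq.
rewrite big_split; congr (_ + _); apply: eq_bigr => k _.
rewrite exchange_big; apply: eq_bigr => r _.
by rewrite fn_partial_ijac nprod_suml.
Qed.

(* [tr (dF G)], that is, minus the logarithmic derivative of the Jacobian
   determinant. *)
Definition anomaly : V := \sum_i \sum_j fn (Fc i j) ∘_(-2) fn (Gc i j).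

Lemma par_anomaly : par false anomaly.
Proof.
apply: par_sum => i _; apply: par_sum => j _.
exact: (par_nprod _ (par_fn _) (par_fn _)).
Qed.

(** The contraction of [b^j] with [c^j] inside the nested Wick products gives the anomaly. In the
    remaining terms the Jacobian meets its inverse, and the sum over [i] collapses to the
    diagonal. *)
Lemma new_bc : \sum_i bt i ∙ ct i = \sum_j bb j ∙ cc j + anomaly.
Proof.
have sFG i j s : csmooth W (fun x => Fc i j x * Gc i s x) by apply: csmoothM.
have pX j i s : pole 1 (bb j) (fn (Gc i s) ∙ cc s).
  move=> m hm; rewrite (nprod_comm0 _ _ _ (par_b j) (par_fn _)).
    by rewrite pole1_gen // nprod0r scaler0.
  exact: pole0_b_fn.
have pY h i s : pole 0 (fn h) (fn (Gc i s) ∙ cc s).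
  apply: (pole0_nprodr _ (par_fn _) (par_fn _)); first exact: pole0_fn_fn.
  exact: pole0_fn_c.
have pbc h j s : pole 0 (fn h) (bb j ∙ cc s).
  exact: (pole0_nprodr _ (par_fn _) (par_b _) (@pole0_fn_b h j) (@pole0_fn_c h s)).
have e i j s : (fn (Fc i j) ∙ bb j) ∙ fn (Gc i s) ∙ cc s
   = fn (fun x => Fc i j x * Gc i s x) ∙ bb j ∙ cc s
     + if j == s then fn (Fc i j) ∘_(-2) fn (Gc i s) else 0.
  rewrite (wick_wick (par_fn _) (par_b j)) //; last exact: pole_le (leqnSn _) (pY _ _ _).
  rewrite (pY _ _ _ 0) // nprod0r scaler0 addr0; congr (_ + _).
    rewrite (nprod_comm0 _ _ _ (par_b j) (par_fn _)); last exact: pole0_b_fn.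
    by rewrite scale1r fn_wickA.
  rewrite (nprod_comm0 _ _ _ (par_b j) (par_fn _)); last exact: pole0_b_fn.
  rewrite scale1r b_c; case: eqP => _; last by rewrite !nprod0r.
  by rewrite nprod_vac.
transitivity (\sum_i \sum_j \sum_s (fn (fun x => Fc i j x * Gc i s x) ∙ bb j ∙ cc s
     + if j == s then fn (Fc i j) ∘_(-2) fn (Gc i s) else 0)).
  apply: eq_bigr => i _; rewrite nprod_suml; apply: eq_bigr => j _.
  by rewrite nprod_sumr; apply: eq_bigr => s _.
under eq_bigr do under eq_bigr do rewrite big_split.
under eq_bigr do rewrite big_split.
rewrite big_split; congr (_ + _); last first.
  apply: eq_bigr => i _; apply: eq_bigr => j _.
  by rewrite -big_mkcond (big_pred1 j).
rewrite exchange_big; apply: eq_bigr => j _; rewrite exchange_big.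
transitivity (\sum_s (if s == j then bb j ∙ cc s else 0)).
  apply: eq_bigr => s _; rewrite -nprod_suml -fn_sum //.
  have -> : fn (fun x => \sum_i Fc i j x * Gc i s x) = fn (fun=> (j == s)%:R).
    apply: fn_eq => //; first exact: csmooth_sum.
    move=> x /set_mem Wx; rewrite -(rmorph_nat (real_complex R)) -(ijac_jac j s Wx) rmorph_sum.
    by apply: eq_bigr => i _; rewrite rmorphM.
  rewrite eq_sym; case: eqP => _; last by rewrite fn0 nprod0l.
  by rewrite fn1 vac_nprod.
by rewrite -big_mkcond big_pred1_eq.
Qed.

Lemma anomaly_zero_mode (x : V) : anomaly ∘_(0) x = 0.
Proof.
have nz (v : V) : (forall h, pole 1 (fn h) v) ->
    anomaly ∘_(0) v = \sum_i \sum_j (fn (Fc i j) ∘_(-2) (fn (Gc i j) ∘_(0) v)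
      - fn (Gc i j) ∘_(-2) (fn (Fc i j) ∘_(0) v)).
  move=> pv; rewrite nprod_suml; apply: eq_bigr => i _; rewrite nprod_suml.
  apply: eq_bigr => j _; rewrite (nprod_zero_mode _ (par_fn _) (par_fn _)) //.
  have -> : (-1 : C) ^ (-2) = ((-1) ^+ 2)^-1 by [].
  by rewrite sqrrN expr1n invr1 mulr1 scale1r.
have z (v : V) : (forall h, pole 0 (fn h) v) -> anomaly ∘_(0) v = 0.
  move=> pv; rewrite nz; last by move=> h; apply: pole_le (pv h).
  by rewrite big1 // => i _; rewrite big1 // => j _; rewrite !pv // !nprod0r subrr.
apply: (zero_mode_eq0 par_anomaly) => -[h|m|i|i]; last 2 first.
- by apply: z => h; apply: pole0_fn_b.
- by apply: z => h; apply: pole0_fn_c.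
- by apply: z => h'; apply: pole_fnl => ?; apply: pole0_gen.
rewrite nz => [|h]; last exact: pole1_fn_beta.
(* These are the derivatives of the coordinate fields. As the derivative of a function is a
   combination of them, both sums become combinations of the [t k], and it suffices to compare
   coefficients. *)
pose t k := transl (fn (cplx (@Defs.coord R n k))).
have tfn k h : pole 0 (t k) (fn h).
  by apply: (pole0_nprodl _ (par_fn _) (par_vac _)); [apply: pole0_fn_fn | apply: pole0_vacl].
have fnt k h : pole 0 (fn h) (t k).
  by apply: (pole0_nprodr _ (par_fn _) (par_fn _)); [apply: pole0_fn_fn | apply: pole0_vacr].
have e2 P Q (dP : 'I_n -> E -> C) : csmooth W P -> csmooth W Q ->
    (forall k, cpartial k P = dP k) ->
    fn P ∘_(-2) fn Q = \sum_k fn (fun x => dP k x * Q x) ∙ t k.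
  move=> sP sQ edP; rewrite -(transl_wick (par_fn _) (@pole0_fn_fn P Q)).
  rewrite fn_transl // nprod_suml; apply: eq_bigr => k _.
  have sdP : csmooth W (dP k) by rewrite -edP; apply: csmooth_cpartial.
  rewrite edP.
  have pt : par false (t k) by apply: (par_nprod _ (par_fn _) (par_vac _)).
  rewrite (wickA (par_fn _) pt); [|exact: pole0_fn_fn|exact: tfn].
  rewrite (wickC pt (par_fn _)); last exact: pole_le (leqnSn _) (tfn _ _).
  by rewrite tfn // /transl nprod0l add0r scale1r fn_wickA.
have e3 (P Q : 'I_n -> 'I_n -> 'I_n -> E -> C) :
    (forall k i j, csmooth W (P k i j)) -> (forall k i j, csmooth W (Q k i j)) ->
    \sum_i \sum_j \sum_k fn (fun x => P k i j x * Q m i j x) ∙ t k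
    = \sum_k fn (fun x => \sum_i \sum_j P k i j x * Q m i j x) ∙ t k.
  move=> sP sQ; have sPQ k i j : csmooth W (fun x => P k i j x * Q m i j x).
    exact: csmoothM.
  under eq_bigr do rewrite exchange_big.
  rewrite exchange_big; apply: eq_bigr => k _; rewrite fn_sum; last first.
    by move=> i; apply: csmooth_sum.
  rewrite nprod_suml; apply: eq_bigr => i _; rewrite fn_sum //.
  by rewrite nprod_suml.
transitivity (- (\sum_i \sum_j \sum_k
    fn (fun x => cplx (dijac k i j) x * cplx (djac m i j) x) ∙ t k)
  + \sum_i \sum_j \sum_k
    fn (fun x => cplx (djac k i j) x * cplx (dijac m i j) x) ∙ t k).
  rewrite -sumrN -big_split; apply: eq_bigr => i _; rewrite -sumrN -big_split.
  apply: eq_bigr => j _; rewrite !fn_beta // !nprodNr opprK cpartial_Fc cpartial_Gc.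
  congr (- _ + _); apply: e2 => // k; [exact: cpartial_Fc|exact: cpartial_Gc].
rewrite (e3 (fun k i j => cplx (dijac k i j)) (fun k i j => cplx (djac k i j))) //.
rewrite (e3 (fun k i j => cplx (djac k i j)) (fun k i j => cplx (dijac k i j))) //.
apply/eqP; rewrite addrC subr_eq0; apply/eqP.
apply: eq_bigr => k _; congr (_ ∙ _); apply: fn_eq => //.
  by apply: csmooth_sum => // i; apply: csmooth_sum => // j; apply: csmoothM.
move=> z' /set_mem Wz; have := partial_jac_ijac_sym k m Wz.
move=> /(congr1 (real_complex R)); rewrite !rmorph_sum /=.
under eq_bigr do rewrite rmorph_sum; under [RHS]eq_bigr do rewrite rmorph_sum.
move=> eq_sums; transitivity (\sum_i \sum_j
    real_complex R (djac k i j z' * dijac m i j z')).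
  by apply: eq_bigr => i _; apply: eq_bigr => j _; rewrite rmorphM.
rewrite -eq_sums.
by apply: eq_bigr => i _; apply: eq_bigr => j _; rewrite rmorphM.
Qed.

(* [Q] is [chD (sum b c)], in the old coordinates as in the new ones. *)
Lemma chQ_new : \sum_i betat i ∙ ct i = chQ + chD anomaly.
Proof.
have <- : chD (\sum_j bb j ∙ cc j) = chQ.
  rewrite chD_sum; apply: eq_bigr => j _.
  by rewrite (chD_der _ _ (par_b j)) chD_b chD_c nprod0r scaler0 addr0.
rewrite -chDD -new_bc chD_sum; apply: eq_bigr => i _.
have pb : par true (bt i).
  by apply: par_sum => j _; apply: (par_nprod _ (par_fn _) (par_b _)).
by rewrite (chD_der _ _ pb) chD_new_b chD_new_c nprod0r scaler0 addr0.
Qed.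

Lemma chD_new (x : V) : (\sum_i betat i ∙ ct i) ∘_(0) x = chD x.
Proof.
rewrite chQ_new nprodDl -[RHS]addr0; congr (_ + _).
have := zero_mode_der x 0 par_chQ par_anomaly.
rewrite !anomaly_zero_mode scaler0 addr0 => <-; exact: chD0.
Qed.

End NewFields.

End ChiralModel.

(** * Forms and conformal weights in [Omega_ch] *)

Section Local.
Variables (R : realType) (n : nat) (W : set 'rV[R]_n).
Hypothesis oW : open W.
Local Notation rho := (@gen R n W).
Local Notation hrho := (@gen_model R n W).

Lemma Om_generated (x : Omega_ch W) : exists u, x = ev rho u.
Proof. by exists (repr x); rewrite ev_gen /cls reprK. Qed.

Lemma fld_gen : fld rho = fnO W.
Proof. by apply/funext => f; rewrite fldE. Qed.

Lemma Dch_gen (x : Omega_ch W) : Dch x = chD rho x.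
Proof. by []. Qed.

Lemma iota_ch_gen (eta : localform R n) : iota_ch W eta = chform rho eta.
Proof. by rewrite /chform fld_gen. Qed.

Lemma csmooth_dform (eta : localform R n) :
  (forall I, csmooth W (eta I)) -> forall I, csmooth W (dform eta I).
Proof.
move=> he I; apply: csmooth_sum => // i; apply: csmoothZ => //.
exact: csmooth_cpartial.
Qed.

Lemma csmooth_wedge (eta theta : localform R n) :
  (forall I, csmooth W (eta I)) -> (forall I, csmooth W (theta I)) ->
  forall I, csmooth W (wedge eta theta I).
Proof.
move=> he ht K; apply: csmooth_sum => // I; apply: csmoothM => //.
exact: csmoothZ.
Qed.

Lemma chformD (eta theta : localform R n) :
  (forall I, csmooth W (eta I)) -> (forall I, csmooth W (theta I)) ->
  chform rho (fun I x => eta I x + theta I x) = chform rho eta + chform rho theta.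
Proof.
move=> he ht; rewrite /chform -big_split; apply: eq_bigr => I _.
by rewrite (fnD hrho) // nprodDl.
Qed.

Lemma chform_eq0 (eta : localform R n) : (forall I, csmooth W (eta I)) ->
  (forall I x, W x -> eta I x = 0) -> chform rho eta = 0.
Proof.
move=> he e; rewrite /chform big1 // => I _.
rewrite (_ : fld rho (eta I) = 0) ?nprod0l // -(fn0 hrho).
by apply: (fn_eq oW hrho) => // x /set_mem; apply: e.
Qed.

Lemma has_weight_sum w (I : Type) (r : seq I) (P : pred I) (F : I -> Omega_ch W) :
  (forall i, has_weight w (F i)) -> has_weight w (\sum_(i <- r | P i) F i).
Proof.
move=> hF; elim/big_rec: _ => [|i x _]; first exact: hw_zero.
exact: hw_add.
Qed.

Lemma has_weight_nprod w w' w'' m (x y : Omega_ch W) : has_weight w x -> has_weight w' y ->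
  w'' = w + w' - m - 1 -> has_weight w'' (x ∘_(m) y).
Proof. by move=> hx hy ->; apply: hw_prod. Qed.

Lemma has_weight_Q : has_weight 1 (Qfield W).
Proof.
apply: has_weight_sum => i.
exact: (has_weight_nprod (hw_gen (GBeta W i)) (hw_gen (GC W i))).
Qed.

Lemma has_weight_iota (eta : localform R n) : has_weight 0 (iota_ch W eta).
Proof.
apply: has_weight_sum => I.
have hf : has_weight 0 (fnO W (eta I)).
  rewrite /fnO /fn; case: pselect => [h|_]; last exact: hw_zero.
  exact: (hw_gen (GFun _)).
apply: (has_weight_nprod hf (w' := 0)) => //; elim: (enum I) => [|i s IH] /=.
  exact: hw_vac.
exact: (has_weight_nprod (hw_gen (GC W i)) IH).
Qed.

Lemma has_weight_D_tw (eta : localform R n) w (x : Omega_ch W) :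
  has_weight w x -> has_weight w (Dch x + iota_ch W eta ∙ x).
Proof.
move=> hx; apply: hw_add; first by apply: (has_weight_nprod has_weight_Q hx); lia.
by apply: (has_weight_nprod (has_weight_iota eta) hx); lia.
Qed.

End Local.

(** * Gluing *)

Section Terms.
Variables (R : realType) (n : nat) (U : set 'rV[R]_n).
Local Notation C := (R[i]).
Variables (V : vertexSuperalgebra C) (rho : chgen U -> V).

(** [glued] asks for expressions, so [Q] is also needed as one, to be evaluated in the old and in
    the new generators. *)
Definition Qterm : chterm U := \big[@TAdd _ _/TZero]_(i < n)
  TProd (-1) (TGen (GBeta U i)) (TGen (GC U i)).

Definition iota_term (eta : localform R n) (h : forall I, csmooth U (eta I)) : chterm U :=
  \big[@TAdd _ _/TZero]_(I : {set 'I_n}) TProd (-1) (TGen (GFun (exist _ (eta I) (h I))))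
    (foldr (fun i u => TProd (-1) (TGen (GC U i)) u) TVac (enum I)).

Lemma ev_sum (I : Type) (r : seq I) (P : pred I) (F : I -> chterm U) :
  ev rho (\big[@TAdd _ _/TZero]_(i <- r | P i) F i) = \sum_(i <- r | P i) ev rho (F i).
Proof. exact: (big_morph (ev rho)). Qed.

Lemma ev_Qterm : ev rho Qterm = \sum_i rho (GBeta U i) ∙ rho (GC U i).
Proof. exact: ev_sum. Qed.

Lemma ev_iota_term (eta : localform R n) (h : forall I, csmooth U (eta I)) :
  ev rho (iota_term h) = \sum_(I : {set 'I_n}) rho (GFun (exist _ (eta I) (h I)))
    ∙ foldr (fun i x => rho (GC U i) ∙ x) vac (enum I).
Proof.
rewrite ev_sum; apply: eq_bigr => I _; congr (_ ∙ _).
by elim: (enum I) => [//|i s IH]; rewrite -[LHS]/(_ ∙ _) IH.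
Qed.

End Terms.

(** * Change of coordinates on expressions *)

Section Gluing.
Variables (R : realType) (n : nat) (U V V' W : set 'rV[R]_n).
Variables g f : 'rV[R]_n -> 'rV[R]_n.
Hypotheses (oW : open W) (WU : W `<=` U) (V'V : V' `<=` V).
Hypothesis gV' : forall x, W x -> V' (g x).
Hypotheses (smg : forall i, rsmooth W (comp_ g i)) (smf : forall i, rsmooth V' (comp_ f i)).
Hypothesis fK : forall x, W x -> f (g x) = x.
Local Notation C := (R[i]).
Local Notation hrho := (@gen_model R n W).

(** The abstract Jacobians in [chD_new] are instantiated by those of [g] and [f]; the new fields
    there are then the images of the generators under [trans_gen]. *)
Lemma ev_trans_Q (x : Omega_ch W) : ev (trans_gen W g f) (Qterm V) ∘_(0) x = Dch x.
Proof.
rewrite ev_Qterm; have := chD_new oW hrho (@Om_generated R n W) smg (fun _ _ => erefl)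
  (smooth_jac smg) (fun _ _ _ => erefl) (fun _ _ _ => erefl)
  (smooth_ijac oW gV' smg smf) (smooth_ihess oW gV' smg smf)
  (ijac_jac oW gV' smg smf fK) (partial_ijac gV' smg smf)
  (ihessE oW gV' smg smf fK) (partial_jac_ijac_sym oW gV' smg smf fK) x.
by rewrite fld_gen; apply: etrans.
Qed.

Lemma pullback_minor (eta : localform R n) (I : {set 'I_n}) x :
  pullback g eta I x = \sum_(J : {set 'I_n} | #|J| == #|I|) (eta J \o g) x
    * cplx (fun z => minor (fun i j => jac g i j z) #|I| (enum I) (enum J)) x.
Proof.
apply: eq_bigr => J _; congr (_ * _%:C%C).
exact: esym (minor_enum (fun i j => jac g i j x) I (enum J)).
Qed.

Lemma ev_trans_iota (etaU etaV : localform R n) (hV : forall I, csmooth V (etaV I)) :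
  (forall I, csmooth U (etaU I)) ->
  (forall I x, W x -> etaU I x = pullback g etaV I x) ->
  ev (trans_gen W g f) (iota_term hV) = iota_ch W etaU.
Proof.
move=> hU e; rewrite ev_iota_term iota_ch_gen.
have sV J : csmooth W (etaV J \o g).
  by apply: (csmooth_comp oW gV' _ smg); apply: csmooth_sub V'V _.
have sU J : csmooth W (etaU J) by apply: csmooth_sub WU _.
have eq_pull I x : W x -> etaU I x = \sum_(J : {set 'I_n} | #|J| == #|I|)
    (etaV J \o g) x * cplx (fun z => minor (fun i j => jac g i j z) #|I| (enum I) (enum J)) x.
  by move=> Wx; rewrite e //; apply: pullback_minor.
have := chform_new oW hrho (smooth_jac smg) sV sU eq_pull.
by rewrite /nword fld_gen; apply: etrans.
Qed.

Lemma ev_res_iota (etaU : localform R n) (hU : forall I, csmooth U (etaU I)) :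
  ev (@res_gen R n U W) (iota_term hU) = iota_ch W etaU.
Proof. exact: ev_iota_term. Qed.

Lemma ev_gen_iota (U0 : set 'rV[R]_n) (eta : localform R n)
    (h : forall I, csmooth U0 (eta I)) :
  ev (@gen R n U0) (iota_term h) = iota_ch U0 eta.
Proof.
rewrite ev_iota_term /iota_ch; apply: eq_bigr => I _; congr (_ ∙ _).
by rewrite -fnE fld_gen.
Qed.

Lemma glued_D_tw (etaU etaV : localform R n) (s : Omega_ch U) (s' : Omega_ch V) :
  (forall I, csmooth U (etaU I)) -> (forall I, csmooth V (etaV I)) ->
  (forall I x, W x -> etaU I x = pullback g etaV I x) ->
  glued W g f s s' ->
  glued W g f (Dch s + iota_ch U etaU ∙ s) (Dch s' + iota_ch V etaV ∙ s').
Proof.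
move=> hU hV e [t [t' [-> -> ett']]].
exists (TAdd (TProd 0 (Qterm U) t) (TProd (-1) (iota_term hU) t)).
exists (TAdd (TProd 0 (Qterm V) t') (TProd (-1) (iota_term hV) t')).
have evE (V0 : vertexSuperalgebra C) (U0 : set 'rV[R]_n) (r : chgen U0 -> V0) a b c d m k :
  ev r (TAdd (TProd m a b) (TProd k c d)) = ev r a ∘_(m) ev r b + ev r c ∘_(k) ev r d.
  by [].
split; rewrite evE.
- congr (_ ∘_(0) _ + _ ∙ _); first by rewrite ev_Qterm.
  by rewrite ev_gen_iota.
- congr (_ ∘_(0) _ + _ ∙ _); first by rewrite ev_Qterm.
  by rewrite ev_gen_iota.
- rewrite evE ev_res_iota (ev_trans_iota hV hU e) ev_trans_Q ett'; congr (_ + _).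
  by rewrite ev_Qterm.
Qed.

End Gluing.

(** * Global sections over an atlas *)

Section Atlas.
Variables (R : realType) (n : nat) (Z : topologicalType) (A : smooth_atlas R n Z).
Implicit Types a b : chart_idx A.

Lemma overlap_sub a b : overlap a b `<=` img a.
Proof. by move=> _ [z [za _] <-]; exists z. Qed.

Lemma open_overlap a b : open (overlap a b).
Proof.
rewrite openE => _ [z [za zb] <-]; rewrite /interior.
have ia : nbhs (chart a z) (img a).
  by apply: open_nbhs_nbhs; split; [exact: chart_img_open | exists z].
have ib : nbhs (chart a z) (chart_inv a @^-1` chart_dom b).
  apply: (chart_inv_cont za); rewrite chartK //.
  by apply: open_nbhs_nbhs; split => //; exact: chart_dom_open.
apply: filterS2 ia ib => _ [z' z'a <-]; rewrite /= chartK // => z'b.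
by exists z'.
Qed.

Lemma tr_overlap a b x : overlap a b x -> overlap b a (tr a b x).
Proof. by move=> [z [za zb] <-]; exists z => //; rewrite /tr /= chartK. Qed.

Lemma trK a b x : overlap a b x -> tr b a (tr a b x) = x.
Proof. by move=> [z [za zb] <-]; rewrite /tr /= !chartK. Qed.

Lemma compatible_D_tw (H : formfam A) (s : chfam A) :
  is_form H -> compatible s -> compatible (D_tw H s).
Proof.
move=> [sH pH] cs a b; apply: (@glued_D_tw _ _ _ _ (overlap b a)) => //.
- exact: open_overlap.
- exact: overlap_sub.
- exact: overlap_sub.
- exact: tr_overlap.
- by move=> i; apply: chart_smooth.
- by move=> i; apply: chart_smooth.
- exact: trK.
- by move=> I x; apply: pH.
Qed.

(** The operator is additive and preserves the conformal weight, so it can be applied to each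
    homogeneous component. *)
Lemma global_section_D_tw (H : formfam A) (s : chfam A) :
  is_form H -> global_section s -> global_section (D_tw H s).
Proof.
move=> hH [N [t [ht st]]]; exists N, (fun w => D_tw H (t w)); split.
  move=> w; have [ct wt] := ht w; split; first exact: compatible_D_tw.
  by move=> a; apply: has_weight_D_tw.
move=> a; rewrite /D_tw st /Dch !nprod_sumr -big_split; exact: eq_bigr.
Qed.

End Atlas.

Theorem lemma3p5 (R : realType) (n : nat) (Z : topologicalType)
    (A : smooth_atlas R n Z)
    (hausZ : hausdorff_space Z) (countZ : @second_countable Z)
    (k : nat) (H : formfam A)
    (H_form : is_form H) (H_deg : of_degree (2 * k + 1)%N H)
    (H_closed : closed_form H) :
  (forall s : chfam A, global_section s -> global_section (D_tw H s))
  /\ (forall eta : formfam A, is_form eta ->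
        forall a, D_tw H (iota_form eta) a = iota_form (d_tw H eta) a)
  /\ (forall s : chfam A, global_section s ->
        forall a, D_tw H (D_tw H s) a = 0).
Proof.
have oi (a : chart_idx A) : open (img a) by exact: chart_img_open.
have sH a I : csmooth (img a) (H a I) by case: H_form => /(_ a I).
split; first by move=> s; apply: global_section_D_tw.
split=> [eta [se _] a|s _ a].
  rewrite /D_tw /iota_form !iota_ch_gen !Dch_gen.
  rewrite (chD_chform (oi a) (@gen_model _ _ _)) //.
  rewrite (chform_wedge (oi a) (@gen_model _ _ _)) //.
  apply/esym/chformD; [exact: csmooth_dform | exact: csmooth_wedge].
rewrite /D_tw /iota_form iota_ch_gen !Dch_gen.
apply: (twisted_sq (@gen_model _ _ _)); first 1 last.
- exact: (pole0_chform (@gen_model _ _ _) _ _).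
- rewrite (chD_chform (oi a) (@gen_model _ _ _)) //.
  apply: (chform_eq0 (oi a)) => [I|I x]; [exact: csmooth_dform | exact: H_closed].
(* As [2 * k + 1] is odd, the coefficients of [H] on sets of even size vanish. *)
- apply: (par_chform (oi a) (@gen_model _ _ _)) => I x Wx oI; apply: H_deg => //.
  by apply: contra oI => /eqP ->; rewrite oddD oddM.
Qed.
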